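(* Let $A,B,C$ be complex vector spaces of dimension $m$, with bases $(a_i)$, $(b_i)$, $(c_i)$, $1\le i\le m$, and let $T\in A\otimes B\otimes C$ be a binding tensor. Then $\dim G_T\le m^2-1$, and equality occurs uniquely (up to isomorphism and up to permutation of the three factors) for the tensor $$T_{u\text{-}triv,m}:=a_1\otimes b_1\otimes c_1+\sum_{\rho=2}^m a_1\otimes b_\rho\otimes c_\rho+\sum_{\rho=2}^m a_\rho\otimes b_1\otimes c_\rho .$$
   Context: The group $GL(A)\times GL(B)\times GL(C)$ acts naturally on $A\otimes B\otimes C$; the kernel of the action is $\{(\lambda\,\mathrm{Id}_A,\mu\,\mathrm{Id}_B,\nu\,\mathrm{Id}_C):\lambda\mu\nu=1\}\cong(\mathbb C^* )^{2}$. The symmetry group $G_T$ of a tensor $T$ is the stabilizer of $T$ in the quotient $(GL(A)\times GL(B)\times GL(C))/(\mathbb C^* )^{2}$. Two tensors are isomorphic if they lie in the same $GL(A)\times GL(B)\times GL(C)$-orbit; isomorphic tensors are identified. A tensor $T$ induces linear maps $T_A:A^*\to B\otimes C$, $T_B:B^*\to A\otimes C$, $T_C:C^*\to A\otimes B$. $T$ is $1_A$-generic if $T_A(A^* )$ contains an element of rank $m$, and $1_B$-, $1_C$-genericity are defined analogously. $T$ is binding if it satisfies at least two of the three conditions $1_A$-generic, $1_B$-generic, $1_C$-generic. *)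

(* Defs.v *)
From mathcomp Require Import all_boot all_order all_algebra all_fingroup.
From mathcomp Require Import classical_sets mpoly.

Set Implicit Arguments.
Unset Strict Implicit.
Unset Printing Implicit Defensive.

Import GRing.Theory.
Local Open Scope ring_scope.
Local Open Scope classical_set_scope.

Section KrullDimension.
Variable X : Type.
(* [cl] is the family of closed sets of a topology on X; [Y] is a subset of X
   with the induced topology. *)
Variable cl : set (set X).

Definition closed_in (Y Z : set X) : Prop := exists2 F, cl F & Z = Y `&` F.

Definition irreducible (Z : set X) : Prop :=
  Z !=set0 /\
  forall F1 F2, cl F1 -> cl F2 -> Z `<=` F1 `|` F2 -> Z `<=` F1 \/ Z `<=` F2.

Definition irreducible_chain (Y : set X) (d : nat) : Prop :=
  exists Z : nat -> set X,
    (forall i, (i <= d)%N -> closed_in Y (Z i) /\ irreducible (Z i)) /\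
    (forall i, (i < d)%N -> Z i `<` Z i.+1).

Definition krull_dim_le (Y : set X) (n : nat) : Prop :=
  forall d, irreducible_chain Y d -> (d <= n)%N.

Definition krull_dim_eq (Y : set X) (n : nat) : Prop :=
  irreducible_chain Y n /\ krull_dim_le Y n.

End KrullDimension.

Section Tensors.
Variables (K : fieldType) (m : nat).

(* The coordinates of an element of A (x) B (x) C in the basis
   a_i (x) b_j (x) c_k, where dim A = dim B = dim C = m. *)
Definition tensor := {ffun 'I_m * 'I_m * 'I_m -> K}.

Definition basis_tensor (i j k : 'I_m) : tensor :=
  [ffun x => (x == (i, j, k))%:R].

(* The images of T_A, T_B, T_C at a covector, as matrices. *)
Definition contractA (T : tensor) (u : 'rV[K]_m) : 'M[K]_m :=
  \matrix_(j, k) \sum_i u 0 i * T (i, j, k).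
Definition contractB (T : tensor) (u : 'rV[K]_m) : 'M[K]_m :=
  \matrix_(i, k) \sum_j u 0 j * T (i, j, k).
Definition contractC (T : tensor) (u : 'rV[K]_m) : 'M[K]_m :=
  \matrix_(i, j) \sum_k u 0 k * T (i, j, k).

Definition genericA (T : tensor) : Prop := exists u, \rank (contractA T u) = m.
Definition genericB (T : tensor) : Prop := exists u, \rank (contractB T u) = m.
Definition genericC (T : tensor) : Prop := exists u, \rank (contractC T u) = m.

Definition binding (T : tensor) : Prop :=
  [\/ genericA T /\ genericB T, genericA T /\ genericC T
    | genericB T /\ genericC T].

Definition mx_triple := ('M[K]_m * 'M[K]_m * 'M[K]_m)%type.

Definition GL3 : set mx_triple :=
  [set g | [/\ g.1.1 \in unitmx, g.1.2 \in unitmx & g.2 \in unitmx]].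

Definition act (g : mx_triple) (T : tensor) : tensor :=
  [ffun x => \sum_i \sum_j \sum_k
     g.1.1 x.1.1 i * g.1.2 x.1.2 j * g.2 x.2 k * T (i, j, k)].

Definition isomorphic (T T' : tensor) : Prop := exists2 g, GL3 g & act g T = T'.

Definition permute_factors (s : 'S_3) (T : tensor) : tensor :=
  [ffun x => let y := [tuple x.1.1; x.1.2; x.2] in
     T (tnth y (s ord0), tnth y (s (Ordinal (isT : (1 < 3)%N))),
        tnth y (s ord_max))].

(* The class of g modulo the kernel
   { (l Id, mu Id, nu Id) : l mu nu = 1 } of the action. *)
Definition kercoset (g : mx_triple) : set mx_triple :=
  [set h | exists l mu nu : K,
     l * mu * nu = 1 /\ h = (l *: g.1.1, mu *: g.1.2, nu *: g.2)].

Definition coords (g : mx_triple) : 'rV[K]_(m * m + m * m + m * m) :=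
  row_mx (row_mx (mxvec g.1.1) (mxvec g.1.2)) (mxvec g.2).

(* The closed sets of the Zariski topology on GL3 modulo the kernel, i.e. the
   quotient topology: the preimage in GL3 is the zero locus of a set of
   polynomials in the matrix entries.  (Regular functions on GL3 may also
   involve inverses of determinants, but these give the same zero loci.)
   Points of the quotient are the sets [kercoset g] with [GL3 g]. *)
Definition quotient_zariski_closed : set (set (set mx_triple)) :=
  [set F | exists S : set {mpoly K[m * m + m * m + m * m]},
     forall g, GL3 g ->
       (F (kercoset g) <-> forall p, S p -> p.@[coords g 0] = 0)].

Definition symmetry_group (T : tensor) : set (set mx_triple) :=
  [set kercoset g | g in [set g | GL3 g /\ act g T = T]].

Definition dim_symmetry_le (T : tensor) (n : nat) : Prop :=
  krull_dim_le quotient_zariski_closed (symmetry_group T) n.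

Definition dim_symmetry_eq (T : tensor) (n : nat) : Prop :=
  krull_dim_eq quotient_zariski_closed (symmetry_group T) n.

End Tensors.

Definition T_utriv (K : fieldType) (n : nat) : tensor K n.+1 :=
  basis_tensor K ord0 ord0 ord0
  + \sum_(r : 'I_n.+1 | r != ord0) basis_tensor K ord0 r r
  + \sum_(r : 'I_n.+1 | r != ord0) basis_tensor K r ord0 r.

(* Main.v *)
Require Import Defs.
From mathcomp Require Import all_boot all_order all_algebra all_fingroup.
From mathcomp Require Import boolp classical_sets mpoly ring zify.
From mathcomp Require Import reals complex.
Import Defs.

Set Implicit Arguments.
Unset Strict Implicit.
Unset Printing Implicit Defensive.

Import Order.TTheory GRing.Theory Num.Theory.
Local Open Scope ring_scope.
Local Open Scope classical_set_scope.

(* View T as a bilinear map mu : A^* x B^* -> C. Up to permuting the factors and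
   isomorphism, a binding T has a common two-sided unit e_0. A stabilizing triple
   satisfies k (mu x y) = mu (g x) (h y) and is determined by a = g e_0, b = h e_0
   and k, where k e_0 = e := mu a b. Write k e_i = w_i + lam_i e with w_i in the
   coordinate hyperplane of vectors without e_0-component. The relation for
   mu e_i e_i is linear in lam_i, so (a, b, w) determines the triple by rational
   functions: the stabilizer in GL3 depends on at most 2 m + (m - 1)^2 = m^2 + 1
   parameters, two of which are killed by the kernel of the action.
   If the bound is attained, the parameters (a, b, w) are dense, so the relations
   hold identically. At a = b = e_0, w_i = 2 e_i they force
   mu (e_i + lam_i e_0) (e_j + lam_j e_0) = 0 for i, j >= 1, i.e. T is T_utriv.
   Conversely the stabilizer of T_utriv contains an explicit rational family with
   m^2 - 1 parameters that can be read off modulo the kernel.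
   A chain of d + 1 irreducible closed sets yields d algebraically independent
   functions, while functions rational in N parameters have transcendence degree
   at most N; this replaces dimension theory. *)

(** * Regular functions and algebraic independence *)

Section RegularFunctions.
Variables (K : numFieldType) (X : Type) (N : nat) (cc : X -> 'rV[K]_N).
Implicit Types (D : set X) (f g h : X -> K) (p q : {mpoly K[N]}).

Definition regular D f := exists p q, forall x, D x ->
  q.@[cc x 0] != 0 /\ f x = p.@[cc x 0] / q.@[cc x 0].

(* Irreducibility of the Zariski closure of D. *)
Definition irr_on D := forall p q,
  (forall x, D x -> p.@[cc x 0] * q.@[cc x 0] = 0) ->
  (forall x, D x -> p.@[cc x 0] = 0) \/ (forall x, D x -> q.@[cc x 0] = 0).

Lemma regular_ext D f g :
  (forall x, D x -> f x = g x) -> regular D f -> regular D g.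
Proof. by move=> fg [p [q H]]; exists p, q => x Dx; rewrite -fg //; apply: H. Qed.

Lemma regular_sub D D' f : D `<=` D' -> regular D' f -> regular D f.
Proof. by move=> DD' [p [q H]]; exists p, q => x /DD'; apply: H. Qed.

Lemma regular_mpoly D p : regular D (fun x => p.@[cc x 0]).
Proof. by exists p, 1 => x _; rewrite meval1 divr1 oner_neq0. Qed.

Lemma regular_coord D i : regular D (fun x => cc x 0 i).
Proof.
apply: regular_ext (regular_mpoly D 'X_i) => x _; exact: mevalXU.
Qed.

Lemma regular_cst D a : regular D (fun=> a).
Proof. apply: regular_ext (regular_mpoly D a%:MP) => x _; exact: mevalC. Qed.

Lemma regularD D f g : regular D f -> regular D g -> regular D (fun x => f x + g x).
Proof.
move=> [p [q H]] [p' [q' H']]; exists (p * q' + p' * q), (q * q') => x Dx.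
have [q0 ->] := H x Dx; have [q0' ->] := H' x Dx.
by rewrite mevalD !mevalM mulf_neq0 // addf_div.
Qed.

Lemma regularM D f g : regular D f -> regular D g -> regular D (fun x => f x * g x).
Proof.
move=> [p [q H]] [p' [q' H']]; exists (p * p'), (q * q') => x Dx.
have [q0 ->] := H x Dx; have [q0' ->] := H' x Dx.
by rewrite !mevalM mulf_neq0 // mulf_div.
Qed.

Lemma regularN D f : regular D f -> regular D (fun x => - f x).
Proof.
move=> rf; apply: regular_ext (regularM (regular_cst D (-1)) rf) => x _.
by rewrite mulN1r.
Qed.

Lemma regularB D f g : regular D f -> regular D g -> regular D (fun x => f x - g x).
Proof. by move=> rf rg; apply: regularD => //; apply: regularN. Qed.

Lemma regularV D f : (forall x, D x -> f x != 0) -> regular D f ->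
  regular D (fun x => (f x)^-1).
Proof.
move=> f0 [p [q H]]; exists q, p => x Dx.
have [q0 fE] := H x Dx; rewrite fE invf_div; split=> //.
by have := f0 x Dx; rewrite fE; apply: contraNneq => ->; rewrite mul0r.
Qed.

Lemma regular_sum D I (r : seq I) (P : pred I) (F : I -> X -> K) :
  (forall i, P i -> regular D (F i)) ->
  regular D (fun x => \sum_(i <- r | P i) F i x).
Proof.
move=> H; elim: r => [|i r IH].
  by apply: regular_ext (regular_cst D 0) => x _; rewrite big_nil.
case Pi: (P i); last by apply: regular_ext IH => x _; rewrite big_cons Pi.
apply: regular_ext (regularD (H i Pi) IH) => x _.
by rewrite big_cons Pi.
Qed.

Lemma regular_prod D I (r : seq I) (P : pred I) (F : I -> X -> K) :
  (forall i, P i -> regular D (F i)) ->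
  regular D (fun x => \prod_(i <- r | P i) F i x).
Proof.
move=> H; elim: r => [|i r IH].
  by apply: regular_ext (regular_cst D 1) => x _; rewrite big_nil.
case Pi: (P i); last by apply: regular_ext IH => x _; rewrite big_cons Pi.
apply: regular_ext (regularM (H i Pi) IH) => x _.
by rewrite big_cons Pi.
Qed.

Lemma regularX D f k : regular D f -> regular D (fun x => f x ^+ k).
Proof.
move=> rf; apply: (regular_ext _ (@regular_prod D _ (index_enum 'I_k) xpredT (fun _ => f) _)) => //.
by move=> x _; rewrite prodr_const card_ord.
Qed.

Lemma irr_on_regular D f g : irr_on D -> regular D f -> regular D g ->
  (forall x, D x -> f x * g x = 0) ->
  (forall x, D x -> f x = 0) \/ (forall x, D x -> g x = 0).
Proof.
move=> iD [p [q H]] [p' [q' H']] fg0.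
have [x Dx|p0|p0] := iD p p'.
- have /eqP := fg0 x Dx; have [q0 ->] := H x Dx; have [q0' ->] := H' x Dx.
  by rewrite !mulf_eq0 !invr_eq0 (negPf q0) (negPf q0') !orbF -mulf_eq0 => /eqP.
- by left=> x Dx; have [_ ->] := H x Dx; rewrite p0 // mul0r.
- by right=> x Dx; have [_ ->] := H' x Dx; rewrite p0 // mul0r.
Qed.

(** Multiplying [p] by [h] makes the product vanish on all of [D], where irreducibility applies. *)
Lemma irr_on_open D h : irr_on D -> regular D h -> irr_on [set x | D x /\ h x != 0].
Proof.
move=> iD rh p q pq.
have [||x Dx|Hp|Hq] := @irr_on_regular D (fun x => h x * p.@[cc x 0]) (fun x => q.@[cc x 0]) iD.
- by apply: regularM => //; apply: regular_mpoly.
- exact: regular_mpoly.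
- rewrite -mulrA; have [->|hx] := eqVneq (h x) 0; first by rewrite mul0r.
  by rewrite pq ?mulr0.
- left=> x [Dx hx]; have /eqP := Hp x Dx.
  by rewrite mulf_eq0 (negPf hx) => /eqP.
- by right=> x [Dx _]; apply: Hq.
Qed.

(* Algebraic independence of the restrictions to D, as linear independence of
   the monomials with exponents in a box. *)
Definition alg_indep D d (f : 'I_d -> X -> K) :=
  forall e (c : {ffun 'I_d -> 'I_e.+1} -> K),
    (forall x, D x -> \sum_a c a * \prod_i f i x ^+ a i = 0) -> forall a, c a = 0.

Lemma alg_indep_sub D D' d (f : 'I_d -> X -> K) : D `<=` D' ->
  alg_indep D f -> alg_indep D' f.
Proof. by move=> DD' li e c H; apply: li => x /DD'; apply: H. Qed.

(** A relation on the open part becomes one on [D] after multiplication by [h], and irreducibility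
    cancels [h]. *)
Lemma alg_indep_open D d (f : 'I_d -> X -> K) h :
  irr_on D -> (forall i, regular D (f i)) -> regular D h ->
  (exists2 x, D x & h x != 0) ->
  alg_indep D f -> alg_indep [set x | D x /\ h x != 0] f.
Proof.
move=> iD rf rh [x Dx hx] li e c H; apply: li => y Dy.
have [|z Dz|h0|->//] := @irr_on_regular D h
   (fun x => \sum_a c a * \prod_i f i x ^+ a i) iD rh.
- apply: regular_sum => a _; apply: regularM; first exact: regular_cst.
  by apply: regular_prod => i _; apply: regularX.
- have [->|hz] := eqVneq (h z) 0; first by rewrite mul0r.
  by rewrite H ?mulr0.
- by move: hx; rewrite h0 ?eqxx.
Qed.

Lemma alg_indep_ext D d (f g : 'I_d -> X -> K) :
  (forall i x, D x -> f i x = g i x) -> alg_indep D f -> alg_indep D g.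
Proof.
move=> fg li e c H; apply: li => x Dx; rewrite -[RHS](H x Dx).
by apply: eq_bigr => a _; congr (_ * _); apply: eq_bigr => i _; rewrite fg.
Qed.

(** In the smallest box the only monomial is 1, and on an empty set the relation 1 = 0 would hold
    vacuously. *)
Lemma alg_indep_neq0 D d (f : 'I_d -> X -> K) : alg_indep D f -> D !=set0.
Proof.
move=> li; apply: contrapT => D0.
suff /eqP : 1 = 0 :> K by rewrite oner_eq0.
by apply: (li 0%N (fun=> 1) _ [ffun=> ord0]) => x Dx; case: D0; exists x.
Qed.

Definition fcons d T (h : T) (f : 'I_d -> T) (i : 'I_d.+1) : T :=
  oapp f h (unlift ord0 i).

Lemma fcons0 d T (h : T) (f : 'I_d -> T) : fcons h f ord0 = h.
Proof. by rewrite /fcons unlift_none. Qed.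

Lemma fcons_lift d T (h : T) (f : 'I_d -> T) i : fcons h f (lift ord0 i) = f i.
Proof. by rewrite /fcons liftK. Qed.

Lemma regular_fcons D d h (f : 'I_d -> X -> K) :
  regular D h -> (forall i, regular D (f i)) ->
  forall i, regular D (fcons h f i).
Proof.
move=> rh rf i; rewrite /fcons; case: unliftP => [j _|_] //=; exact: rf.
Qed.

Lemma big_ffun_cons d e (F : {ffun 'I_d.+1 -> 'I_e} -> K) :
  \sum_a F a = \sum_k \sum_(b : {ffun 'I_d -> 'I_e}) F (finfun (fcons k b)).
Proof.
rewrite pair_big /= (reindex (fun u : 'I_e * {ffun 'I_d -> 'I_e} => finfun (fcons u.1 u.2))) //=.
exists (fun a : {ffun 'I_d.+1 -> 'I_e} =>
  (a ord0, [ffun i => a (lift ord0 i)])) => [[k b] _|a _] /=.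
  by rewrite ffunE fcons0; congr (_, _); apply/ffunP => i; rewrite !ffunE fcons_lift.
apply/ffunP => i; rewrite ffunE.
by case: (unliftP ord0 i) => [j|] ->; rewrite ?fcons_lift ?fcons0 ?ffunE.
Qed.

(* A relation of least order in h restricts to D, where h vanishes, to a
   relation between the f i; irreducibility of D' allows dividing by h. *)
Lemma alg_indep_cons D D' d (f : 'I_d -> X -> K) h :
  D `<=` D' -> irr_on D' -> (forall i, regular D' (f i)) -> regular D' h ->
  (forall x, D x -> h x = 0) -> (exists2 x, D' x & h x != 0) ->
  alg_indep D f -> alg_indep D' (fcons h f).
Proof.
move=> DD' iD' rf rh h0 [y Dy hy] li e c H.
have main : forall E (g : nat -> {ffun 'I_d -> 'I_e.+1} -> K),
    (forall x, D' x ->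
       \sum_(k < E) h x ^+ k * \sum_b g k b * \prod_i f i x ^+ b i = 0) ->
    forall k, (k < E)%N -> forall b, g k b = 0.
  elim=> [//|E IH] g Hg.
  have g00 : forall b, g 0%N b = 0.
    apply: li => x Dx; rewrite -[RHS](Hg x (DD' _ Dx)) big_ord_recl expr0 mul1r.
    by rewrite [X in _ = _ + X]big1 ?addr0 // => k _; rewrite h0 // expr0n mul0r.
  have Hg' x : D' x -> h x * (\sum_(k < E) h x ^+ k *
     \sum_b g k.+1 b * \prod_i f i x ^+ b i) = 0.
    move=> Dx; rewrite -[RHS](Hg x Dx) big_ord_recl.
    rewrite [X in _ * X + _]big1 ?mulr0 ?add0r => [|b _]; last by rewrite g00 mul0r.
    by rewrite mulr_sumr; apply: eq_bigr => k _; rewrite mulrA -exprS.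
  have [|h0'|R0] := irr_on_regular iD' rh _ Hg'.
  - apply: regular_sum => k _; apply: regularM; first exact: regularX.
    apply: regular_sum => b _; apply: regularM; first exact: regular_cst.
    by apply: regular_prod => i _; apply: regularX.
  - by rewrite h0' ?eqxx in hy.
  by case=> [_|k] //; rewrite ltnS; apply: (IH (fun k => g k.+1)).
(* The given relation is regrouped by the exponent of [h]; [inord] only turns that exponent, which
   stays below [e.+1], back into a bounded index. *)
move=> a; have := main e.+1 (fun k b => c (finfun (fcons (inord k) b))) _ (a ord0) (ltn_ord _)
   [ffun i => a (lift ord0 i)].
rewrite inord_val => <-; first congr (c _).
  apply/ffunP => i; rewrite ffunE.
  by case: (unliftP ord0 i) => [j|] ->; rewrite ?fcons_lift ?fcons0 ?ffunE.
move=> x Dx; rewrite -[RHS](H x Dx) big_ffun_cons; apply: eq_bigr => k _.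
rewrite mulr_sumr; apply: eq_bigr => b _; rewrite inord_val mulrCA; congr (_ * _).
rewrite big_ord_recl ffunE !fcons0; congr (_ * _); apply: eq_bigr => i _.
by rewrite ffunE !fcons_lift.
Qed.

Let bnd B p := forall m, m \in msupp p -> (mdeg m <= B)%N.

Let bnd1 : bnd 0 1.
Proof. by move=> m; rewrite msupp1 inE => /eqP ->; rewrite mdeg0. Qed.

Let bndM A B p q : bnd A p -> bnd B q -> bnd (A + B) (p * q).
Proof.
move=> Hp Hq m /msuppM_le /allpairsP [[m1 m2] /= [m1p m2q ->]].
by rewrite mdegD leq_add ?Hp ?Hq.
Qed.

Let bnd_exp B p k : bnd B p -> bnd (k * B) (p ^+ k).
Proof. by move=> Hp; elim: k => [|k IH]; rewrite ?expr0 // exprS mulSn; apply: bndM. Qed.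

Let bnd_prod d B (F : 'I_d -> {mpoly K[N]}) :
  (forall i, bnd B (F i)) -> bnd (d * B) (\prod_i F i).
Proof.
move=> H; elim: d F H => [|d IH] F H; first by rewrite big_ord0.
by rewrite big_ord_recl mulSn; apply: bndM => //; apply: IH.
Qed.

(* Counting: with P_i, Q_i of degree at most B, the (e+1)^d box monomials in
   P_i / Q_i, cleared of denominators, live in a space of dimension at most
   (d e B + 1)^N. *)
Lemma alg_indep_leq D d (f : 'I_d -> X -> K) :
  (forall i, regular D (f i)) -> alg_indep D f -> (d <= N)%N.
Proof.
move=> rf li; rewrite leqNgt; apply/negP => Nd.
have /choice [P /choice [Q H]] := rf.
pose B := (\sum_i (msize (P i) + msize (Q i)))%N.
have bndPQ i : bnd B (P i) /\ bnd B (Q i).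
  by split=> m /msize_mdeg_lt /ltnW /leq_trans; apply;
     rewrite /B (bigD1 i) //= -addnA ?leq_addr // addnCA leq_addr.
(* This choice gives (d B + 1)^N (e + 1)^N < (e + 1)^(N + 1) <= (e + 1)^d. *)
have [e eB] : exists e, ((d * B).+1 ^ N < e.+1)%N by exists ((d * B).+1 ^ N)%N.
have [E EE] : exists E, E = (d * (e * B))%N by exists (d * (e * B))%N.
pose pp (a : {ffun 'I_d -> 'I_e.+1}) := \prod_i (P i ^+ a i * Q i ^+ (e - a i)).
have bpp a : bnd E (pp a).
  rewrite EE; apply: bnd_prod => i.
  have ae : (a i <= e)%N by rewrite -ltnS.
  rewrite -[X in (X * B)%N](subnKC ae) mulnDl.
  by apply: bndM; apply: bnd_exp; case: (bndPQ i).
pose mm (b : {ffun 'I_N -> 'I_E.+1}) := [multinom (b i : nat) | i < N].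
pose A : 'M[K]_(#|{ffun 'I_d -> 'I_e.+1}|, #|{ffun 'I_N -> 'I_E.+1}|) :=
  \matrix_(i, j) (pp (enum_val i))@_(mm (enum_val j)).
(* Rows index box monomials and columns index coefficients; having more rows than columns yields a
   linear relation among the [pp a]. *)
have : kermx A != 0.
  rewrite kermx_eq0 /row_free ltn_eqF //.
  apply: leq_ltn_trans (rank_leq_col _) _.
  rewrite !card_ffun !card_ord.
  apply: (@leq_ltn_trans ((d * B).+1 ^ N * e.+1 ^ N)%N).
    rewrite -expnMn EE; case: (posnP N) => [->//|N0]; rewrite leq_exp2r //; nia.
  apply: (@leq_trans (e.+1 ^ N.+1)%N); last by rewrite leq_pexp2l.
  by rewrite expnS ltn_mul2r expn_gt0 eB.
case/rowV0Pn=> v /sub_kermxP vA; apply/negP; rewrite negbK.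
have c0 := li e (fun a => v 0 (enum_rank a)) _.
apply/eqP/rowP => j; rewrite mxE -[j]enum_valK; apply: c0 => x Dx.
have S0 : \sum_a v 0 (enum_rank a) *: pp a = 0.
  apply/mpolyP => m; rewrite mcoeff0.
  have [Em|Em] := leqP (mdeg m) E; last first.
    rewrite raddf_sum big1 // => a _; rewrite /= mcoeffZ memN_msupp_eq0 ?mulr0 //.
    by apply/negP => /bpp; rewrite leqNgt Em.
  have mE i : (m i < E.+1)%N.
    by rewrite ltnS (leq_trans _ Em) // mdegE (bigD1 i) //= leq_addr.
  have -> : m = mm [ffun i => Ordinal (mE i)].
    by apply/mnmP => i; rewrite mnmE ffunE.
  have /rowP/(_ (enum_rank [ffun i => Ordinal (mE i)])) := vA.
  rewrite !mxE => vA0; rewrite -[RHS]vA0 raddf_sum /=.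
  rewrite (reindex (@enum_rank _)) /=; last first.
    by exists enum_val => ? _; rewrite ?enum_rankK ?enum_valK.
  apply: eq_bigr => a _; by rewrite mcoeffZ mxE !enum_rankK.
have Q0 : \prod_i (Q i).@[cc x 0] ^+ e != 0.
  by apply/prodf_neq0 => i _; rewrite expf_neq0 //; case: (H i x Dx).
apply: (mulfI Q0); rewrite mulr0 -[RHS](meval0 (cc x 0)) -S0 raddf_sum /= mulr_sumr.
apply: eq_bigr => a _; rewrite mevalZ mulrCA; congr (_ * _).
rewrite rmorph_prod -big_split; apply: eq_bigr => i _ /=.
have [q0 ->] := H i x Dx; rewrite mevalM !rmorphXn /=.
have ae : (a i <= e)%N by rewrite -ltnS.
rewrite -{1}(subnK ae) exprD expr_div_n.
by rewrite mulrC; field; rewrite expf_neq0.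
Qed.

(** Were [h] nonzero somewhere, it could be adjoined to the [f i] on the open set where their
    denominators do not vanish, giving more than [N] independent functions. *)
Lemma alg_indep_dense D d (f : 'I_d -> X -> K) (h : X -> K) :
  irr_on setT -> (forall i, regular D (f i)) -> alg_indep D f ->
  regular setT h -> (forall x, D x -> h x = 0) -> (N <= d)%N -> forall x, h x = 0.
Proof.
move=> iT rf li rh h0 Nd x; apply/eqP; apply: contraLR Nd => hx; rewrite -ltnNge.
have /choice [P /choice [Q H]] := rf.
pose q x := \prod_i (Q i).@[cc x 0].
have rq D' : regular D' q by apply: regular_prod => i _; apply: regular_mpoly.
pose D' := [set x | setT x /\ q x != 0].
have Dq : D `<=` D'.
  by move=> z Dz; split=> //; apply/prodf_neq0 => i _; case: (H i z Dz).
have iD' : irr_on D' by apply: irr_on_open.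
(* The fractions representing the [f i] extend them from [D] to the open set [D']. *)
pose g i x := (P i).@[cc x 0] / (Q i).@[cc x 0].
have rg i : regular D' (g i).
  exists (P i), (Q i) => z [_ qz]; split=> //; move: qz => /prodf_neq0; exact.
have lig : alg_indep D g.
  apply: alg_indep_ext li => i z Dz; by case: (H i z Dz).
apply: (@alg_indep_leq D' d.+1 (fcons h g)).
  apply: regular_fcons => //; exact: regular_sub rh.
apply: (alg_indep_cons Dq) => //; first exact: regular_sub rh.
have [[z Dz hz]|nE] := pselect (exists2 x, D' x & h x != 0); first by exists z.
have [|z _|q0|h00] := @irr_on_regular setT q h iT _ rh.
- exact: rq.
- apply/eqP; rewrite mulf_eq0 -implyNb; apply/implyP => qz.
  by apply/negPn/negP => hz; apply: nE; exists z; rewrite // /D' /=.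
- case: (alg_indep_neq0 li) => z Dz.
  by have [_ /eqP] := Dq z Dz; rewrite q0.
- by move: hx; rewrite h00 ?eqxx.
Qed.

End RegularFunctions.

(** * Composition with regular maps, and images of irreducible sets *)

Section Composition.
Variables (K : numFieldType) (X Y : Type) (N M : nat).
Variables (cc : X -> 'rV[K]_N) (dd : Y -> 'rV[K]_M).

Definition regular_map (E : set Y) (u : Y -> X) :=
  forall i, regular dd E (fun y => cc (u y) 0 i).

Lemma regular_comp (D : set X) (E : set Y) u f :
  regular_map E u -> (forall y, E y -> D (u y)) -> regular cc D f ->
  regular dd E (fun y => f (u y)).
Proof.
move=> ru uD [p [q H]].
have rmp (r : {mpoly K[N]}) : regular dd E (fun y => r.@[cc (u y) 0]).
  apply: (@regular_ext _ _ _ _ _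
    (fun y => \sum_(m <- msupp r) r@_m * \prod_i (cc (u y) 0 i) ^+ m i)).
    by move=> y _; rewrite mevalE.
  apply: regular_sum => m _; apply: regularM; first exact: regular_cst.
  by apply: regular_prod => i _; apply: regularX.
apply: (@regular_ext _ _ _ _ _ (fun y => p.@[cc (u y) 0] * (q.@[cc (u y) 0])^-1)).
  by move=> y /uD /H [_ ->].
by apply: regularM => //; apply: regularV => // y /uD /H [].
Qed.

Lemma irr_on_image (E : set Y) u : irr_on dd E -> regular_map E u -> irr_on cc (u @` E).
Proof.
move=> iE ru p q pq.
have rp (r : {mpoly K[N]}) : regular dd E (fun y => r.@[cc (u y) 0]).
  by apply: (regular_comp (D := setT) (f := fun x => r.@[cc x 0]) ru) => //; apply: regular_mpoly.
have [y Ey|p0|q0] := irr_on_regular iE (rp p) (rp q).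
- by apply: pq; exists y.
- by left=> _ [y Ey <-]; apply: p0.
- by right=> _ [y Ey <-]; apply: q0.
Qed.

End Composition.

Lemma alg_indep_comp (K : numFieldType) (X Y : Type) (D : set X) (E : set Y)
    (u : Y -> X) d (f : 'I_d -> X -> K) :
  D `<=` u @` E -> alg_indep D f -> alg_indep E (fun i y => f i (u y)).
Proof.
move=> DuE li e c H; apply: li => x /DuE [y Ey <-]; exact: H.
Qed.

(** * Irreducibility by joining points with rational curves *)

Section Curves.
Variable K : numFieldType.

Definition line_coord (s : K) : 'rV[K]_1 := const_mx s.

(** In characteristic zero the integers below [size p] are distinct roots, one more than a nonzero
    polynomial allows. *)
Lemma poly_vanish (p : {poly K}) : (forall s, p.[s] = 0) -> p = 0.
Proof.
move=> p0; apply/eqP; apply: contraT => pn0.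
have := max_poly_roots pn0 (rs := [seq k%:R | k <- iota 0 (size p)]).
rewrite size_map size_iota ltnn => H; apply: H.
  by apply/allP => s _; apply/eqP.
by rewrite map_inj_uniq ?iota_uniq // => a b /eqP; rewrite eqr_nat => /eqP.
Qed.

Lemma regular_line_id E : regular line_coord E id.
Proof.
by apply: regular_ext (regular_coord _ _ 0) => s _; rewrite mxE.
Qed.

Lemma irr_on_line : irr_on line_coord setT.
Proof.
have to_poly (p : {mpoly K[1]}) : exists P : {poly K}, forall s, P.[s] = p.@[line_coord s 0].
  exists (\sum_(m <- msupp p) p@_m *: \prod_(i < 1) 'X ^+ m i) => s.
  rewrite mevalE horner_sum; apply: eq_bigr => m _.
  rewrite hornerZ horner_prod; congr (_ * _); apply: eq_bigr => i _.
  by rewrite horner_exp hornerX mxE.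
move=> p q pq; have [P PE] := to_poly p; have [Q QE] := to_poly q.
have /eqP : P * Q = 0 by apply: poly_vanish => s; rewrite hornerM PE QE pq.
rewrite mulf_eq0 => /orP[] /eqP e0; [left|right] => s _; by rewrite -?PE -?QE e0 horner0.
Qed.

(** If [p] is nonzero at [x] and [q] at [y], neither vanishes identically on the curve joining these
    points inside [D]. That curve is the image of an open part of the line, hence irreducible, so
    the product cannot vanish on it. *)
Lemma irr_on_curves (X : Type) N (cc : X -> 'rV[K]_N) (D : set X) :
  (forall x y, D x -> D y -> exists (u : K -> X) (h : K -> K) (a b : K),
     [/\ u a = x /\ u b = y, h a != 0 /\ h b != 0, regular line_coord setT h,
         forall s, h s != 0 -> D (u s)
       & regular_map cc line_coord [set s | h s != 0] u]) ->
  irr_on cc D.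
Proof.
move=> H p q pq; apply: contrapT => /not_orP [].
move=> /existsNP [x /not_implyP [Dx px]] /existsNP [y /not_implyP [Dy qy]].
have [u [h [a [b [[ua ub] [ha hb] rh hD ru]]]]] := H x y Dx Dy.
have ih : irr_on line_coord [set s | h s != 0].
  move=> p' q' pq'; have [s [_]|p0|q0] := irr_on_open irr_on_line rh (p := p') (q := q').
  - exact: pq'.
  - by left=> s hs; apply: p0.
  - by right=> s hs; apply: q0.
have := irr_on_image ih ru (p := p) (q := q).
case=> [_ [s hs <-]|p0|q0]; first by apply: pq; apply: hD.
- by apply: px; apply: p0; exists a.
- by apply: qy; apply: q0; exists b.
Qed.

Lemma irr_on_space (X : Type) N (cc : X -> 'rV[K]_N) (dd : 'rV[K]_N -> X) :
  cancel cc dd -> cancel dd cc -> irr_on cc setT.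
Proof.
move=> ccK ddK; apply: irr_on_curves => x y _ _.
exists (fun s => dd (cc x + s *: (cc y - cc x))), (fun=> 1), 0, 1; split=> //.
- by rewrite scale0r addr0 scale1r addrC subrK !ccK.
- by rewrite oner_neq0.
- exact: regular_cst.
- move=> i; have rs := regular_line_id [set s : K | 1 != 0 :> K].
  have := regularD (regular_cst line_coord _ (cc x 0 i))
     (regularM rs (regular_cst line_coord _ ((cc y - cc x) 0 i))).
  by apply: regular_ext => s _; rewrite ddK !mxE.
Qed.

End Curves.

(** * Matrices of regular functions *)

Section RegularMatrices.
Variables (K : numFieldType) (X : Type) (N : nat) (cc : X -> 'rV[K]_N).
Variable D : set X.

Definition regular_mx p q (F : X -> 'M[K]_(p, q)) :=
  forall i j, regular cc D (fun x => F x i j).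

Lemma regular_mxM p q r (F : X -> 'M[K]_(p, q)) (G : X -> 'M[K]_(q, r)) :
  regular_mx F -> regular_mx G -> regular_mx (fun x => F x *m G x).
Proof.
move=> rF rG i j; have : regular cc D (fun x => \sum_k F x i k * G x k j).
  by apply: regular_sum => k _; apply: regularM.
by apply: regular_ext => x _; rewrite mxE.
Qed.

Lemma regular_mx_cst p q (A : 'M[K]_(p, q)) : regular_mx (fun=> A).
Proof. by move=> i j; apply: regular_cst. Qed.

Lemma regular_tr p q (F : X -> 'M[K]_(p, q)) :
  regular_mx F -> regular_mx (fun x => (F x)^T).
Proof. by move=> rF i j; apply: regular_ext (rF j i) => x _; rewrite mxE. Qed.

Lemma regular_det p (F : X -> 'M[K]_p) : regular_mx F -> regular cc D (fun x => \det (F x)).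
Proof.
move=> rF; apply: regular_sum => s _; apply: regularM; first exact: regular_cst.
by apply: regular_prod => i _.
Qed.

Lemma regular_invmx p (F : X -> 'M[K]_p) :
  (forall x, D x -> F x \in unitmx) -> regular_mx F -> regular_mx (fun x => invmx (F x)).
Proof.
move=> uF rF i j.
have : regular cc D (fun x => (\det (F x))^-1 * ((-1) ^+ (j + i) * \det (row' j (col' i (F x))))).
  apply: regularM.
    apply: regularV; last exact: regular_det.
    by move=> x /uF; rewrite unitmxE unitfE.
  apply: regularM; first exact: regular_cst.
  by apply: regular_det => k l; apply: regular_ext (rF (lift j k) (lift i l)) => x _; rewrite !mxE.
by apply: regular_ext => x Dx; rewrite /invmx uF // !mxE.
Qed.

End RegularMatrices.

(** * Chains in the symmetry group *)

Section Triples.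
Variables (K : numFieldType) (m : nat).
Local Notation triple := (mx_triple K m).
Local Notation cc := (@coords K m).

Lemma regular_fst (D : set triple) : regular_mx cc D (fun g => g.1.1).
Proof.
move=> i j.
by apply: regular_ext (regular_coord _ _ (lshift _ (lshift _ (mxvec_index i j)))) => g _;
   rewrite /coords !row_mxEl mxvecE.
Qed.

Lemma regular_snd (D : set triple) : regular_mx cc D (fun g => g.1.2).
Proof.
move=> i j.
by apply: regular_ext (regular_coord _ _ (lshift _ (rshift _ (mxvec_index i j)))) => g _;
   rewrite /coords row_mxEl row_mxEr mxvecE.
Qed.

Lemma regular_thd (D : set triple) : regular_mx cc D (fun g => g.2).
Proof.
move=> i j.
by apply: regular_ext (regular_coord _ _ (rshift _ (mxvec_index i j))) => g _;
   rewrite /coords row_mxEr mxvecE.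
Qed.

Lemma regular_map_triple (Y : Type) M (dd : Y -> 'rV[K]_M) (E : set Y) (u : Y -> triple) :
  regular_mx dd E (fun y => (u y).1.1) -> regular_mx dd E (fun y => (u y).1.2) ->
  regular_mx dd E (fun y => (u y).2) -> regular_map cc dd E u.
Proof.
move=> r1 r2 r3 i; case: (split_ordP i) => [i' ->|i' ->]; last first.
  case/mxvec_indexP: i' => a b; apply: regular_ext (r3 a b) => y _.
  by rewrite /coords row_mxEr mxvecE.
case: (split_ordP i') => [i'' ->|i'' ->]; case/mxvec_indexP: i'' => a b.
  apply: regular_ext (r1 a b) => y _.
  by rewrite /coords !row_mxEl mxvecE.
apply: regular_ext (r2 a b) => y _.
by rewrite /coords row_mxEl row_mxEr mxvecE.
Qed.

Definition scale3 (l mu nu : K) (g : triple) : triple :=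
  (l *: g.1.1, mu *: g.1.2, nu *: g.2).

Lemma scale3_regular l mu nu D : regular_map cc cc D (scale3 l mu nu).
Proof.
have rs (a : K) (F : triple -> 'M[K]_m) :
    regular_mx cc D F -> regular_mx cc D (fun g => a *: F g).
  move=> rF i j; apply: regular_ext (regularM (regular_cst _ _ a) (rF i j)) => g _.
  by rewrite mxE.
apply: regular_map_triple; apply: rs.
- exact: regular_fst.
- exact: regular_snd.
- exact: regular_thd.
Qed.

(** Closed sets depend only on zero loci, so the numerator of the composite with the scaling can
    serve as [P]. *)
Lemma scale3_mpoly l mu nu (p : {mpoly K[m * m + m * m + m * m]}) :
  exists P : {mpoly K[m * m + m * m + m * m]}, forall g,
    P.@[cc g 0] = 0 <-> p.@[cc (scale3 l mu nu g) 0] = 0.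
Proof.
have [P [Q H]] : regular cc setT (fun h => p.@[cc (scale3 l mu nu h) 0]).
  apply: (regular_comp (cc := cc) (D := setT) (f := fun h => p.@[cc h 0])) => //.
  - exact: scale3_regular.
  - exact: regular_mpoly.
exists P => g; have [Q0 ->] := H g I; split=> [->|/eqP]; first by rewrite mul0r.
by rewrite mulf_eq0 invr_eq0 (negPf Q0) orbF => /eqP.
Qed.

Lemma kercoset_refl (g : triple) : kercoset g g.
Proof.
exists 1, 1, 1; split; first by rewrite !mulr1.
by rewrite !scale1r; case: g => [[]].
Qed.

Lemma kercoset_sym (g h : triple) : kercoset g h -> kercoset h g.
Proof.
move=> [l [mu [nu [e ->]]]]; exists l^-1, mu^-1, nu^-1.
have : l * mu * nu != 0 by rewrite e oner_neq0.
rewrite !mulf_eq0 !negb_or => /andP[/andP[l0 mu0] nu0]; split.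
  by rewrite -!invfM e invr1.
by rewrite /= !scalerA !mulVf // !scale1r; case: g => [[]].
Qed.

Lemma kercoset_trans (g h k : triple) : kercoset g h -> kercoset h k -> kercoset g k.
Proof.
move=> [l [mu [nu [e ->]]]] [l' [mu' [nu' [e' ->]]]].
exists (l' * l), (mu' * mu), (nu' * nu); rewrite /= !scalerA; split=> //.
by rewrite -[RHS]mulr1 -{1}e -e'; ring.
Qed.

Lemma kercoset_eqP (g h : triple) : kercoset g = kercoset h <-> kercoset g h.
Proof.
split=> [->|gh]; first exact: kercoset_refl.
apply/seteqP; split=> k; last exact: kercoset_trans.
by apply: kercoset_trans; apply: kercoset_sym.
Qed.

Lemma kercoset_GL3 (g h : triple) : kercoset g h -> GL3 g -> GL3 h.
Proof.
move=> [l [mu [nu [e ->]]]] [u1 u2 u3].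
have : l * mu * nu != 0 by rewrite e oner_neq0.
rewrite !mulf_eq0 !negb_or => /andP[/andP[l0 mu0] nu0].
by split; rewrite /= unitmxZ ?unitfE.
Qed.

Lemma kercoset_act (g h : triple) T : kercoset g h -> act h T = act g T.
Proof.
move=> [l [mu [nu [e ->]]]]; apply/ffunP => x; rewrite !ffunE.
apply: eq_bigr => i _; apply: eq_bigr => j _; apply: eq_bigr => k _.
rewrite !mxE -[g.1.1 _ _ * _ * _ in RHS]mul1r -e; ring.
Qed.

Definition stabilizer (T : tensor K m) : set triple := [set g | GL3 g /\ act g T = T].

Lemma symmetry_groupP T (g : triple) : GL3 g ->
  symmetry_group T (kercoset g) <-> act g T = T.
Proof.
move=> ug; split=> [[h [uh hT] /kercoset_eqP nondeg_fun]|gT]; last by exists g.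
by rewrite (kercoset_act T nondeg_fun).
Qed.

(* The coset is the image of the irreducible torus (K^* )^2. *)
Lemma irr_on_kercoset (g : triple) : irr_on cc (kercoset g).
Proof.
pose D := [set v : 'rV[K]_2 | setT v /\ v 0 0 * v 0 1 != 0].
have rc (i : 'I_2) E : regular (fun v : 'rV[K]_2 => v) E (fun v => v 0 i).
  exact: (regular_coord (fun v : 'rV[K]_2 => v)).
have iD : irr_on (fun v : 'rV[K]_2 => v) D.
  apply: irr_on_open; last by apply: regularM.
  exact: (@irr_on_space _ _ _ (fun v : 'rV[K]_2 => v) (fun v => v)).
pose u (v : 'rV[K]_2) := scale3 (v 0 0) (v 0 1) (v 0 0 * v 0 1)^-1 g.
have ru : regular_map cc (fun v : 'rV[K]_2 => v) D u.
  have rs f (A : 'M[K]_m) : regular (fun v : 'rV[K]_2 => v) D f ->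
      regular_mx (fun v : 'rV[K]_2 => v) D (fun v => f v *: A).
    move=> rf i j; apply: regular_ext (regularM rf (regular_cst _ _ (A i j))) => v _.
    by rewrite mxE.
  apply: regular_map_triple; apply: rs => //.
  by apply: regularV; [move=> v [] | apply: regularM].
suff <- : u @` D = kercoset g by apply: irr_on_image iD ru.
apply/seteqP; split=> [_ [v [_ v0] <-]|_ [l [mu [nu [e ->]]]]].
  by exists (v 0 0), (v 0 1), (v 0 0 * v 0 1)^-1; rewrite divff.
have lm : l * mu != 0.
  by apply/eqP => lm; move/eqP: e; rewrite lm mul0r eq_sym oner_eq0.
exists (\row_i (if i == 0 then l else mu)).
  by rewrite /D /= !mxE /=; split.
rewrite /u /scale3 !mxE /=; congr (_, _, _ *: _).
by apply: (mulfI lm); rewrite divff.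
Qed.

(** The fibres of the quotient map are irreducible: each coset in [Z] lies in the zero locus of [p]
    or of [q], which covers [Z] by two closed sets. *)
Lemma irr_on_preimage (Z : set (set triple)) :
  (forall c, Z c -> exists2 g, GL3 g & c = kercoset g) ->
  irreducible (@quotient_zariski_closed K m) Z ->
  irr_on cc [set g | GL3 g /\ Z (kercoset g)].
Proof.
move=> Zg [_ iZ] p q pq.
(* Requiring vanishing on the whole coset makes this a condition on classes. It is closed because
   the rescalings of [r] are among its equations. *)
pose F (r : {mpoly K[m * m + m * m + m * m]}) : set (set triple) :=
  [set c | forall g, GL3 g -> kercoset g = c -> r.@[cc g 0] = 0].
have Fcl r : quotient_zariski_closed (F r).
  exists [set P | forall g, GL3 g -> (forall g', kercoset g g' -> r.@[cc g' 0] = 0) ->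
                  P.@[cc g 0] = 0] => g ug; split.
    move=> Fg P; apply=> // g' gg'; apply: Fg; first exact: kercoset_GL3 ug.
    by apply/esym/kercoset_eqP.
  move=> HS g' ug' /esym/kercoset_eqP [l [mu [nu [e g'E]]]].
  have [P HP] := scale3_mpoly l mu nu r.
  rewrite g'E; apply/HP/HS => // h uh Hh; apply/HP/Hh.
  by exists l, mu, nu.
have [c Zc|Fp|Fq] := iZ (F p) (F q) (Fcl p) (Fcl q).
- have [g ug cE] := Zg c Zc.
  have [h gh|p0|q0] := irr_on_kercoset (g := g) (p := p) (q := q).
  + apply: pq; split; first exact: kercoset_GL3 ug.
    by rewrite -(proj2 (kercoset_eqP g h) gh) -cE.
  + by left=> h uh; rewrite cE => /esym/kercoset_eqP; apply: p0.
  + by right=> h uh; rewrite cE => /esym/kercoset_eqP; apply: q0.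
- by left=> g [ug Zc]; apply: (Fp _ Zc).
- by right=> g [ug Zc]; apply: (Fq _ Zc).
Qed.

End Triples.

(** * From chains of closed sets to independent functions *)

Section Chains.
Variables (K : numFieldType) (n : nat).
Local Notation triple := (mx_triple K n.+1).
Local Notation cc := (@coords K n.+1).

Lemma unitmx_entry (A : 'M[K]_n.+1) : A \in unitmx -> exists ij, A ij.1 ij.2 != 0.
Proof.
move=> uA; apply: contrapT => H; have A0 : A = 0.
  apply/matrixP => i j; rewrite mxE; apply: contrapT => /eqP Aij.
  by apply: H; exists (i, j).
by move: uA; rewrite A0 unitmxE det0 unitr0.
Qed.

Lemma alg_indep0 (X : Type) (D : set X) (f : 'I_0 -> X -> K) x : D x -> alg_indep D f.
Proof.
move=> Dx e c H a; rewrite -[RHS](H x Dx) (bigD1 a) //= big_ord0 mulr1 big1 ?addr0 // => b.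
by case/eqP; apply/ffunP => -[].
Qed.

(** The coset is a two-dimensional torus. Along the point [g], the curve [D1] and the coset, [h2]
    and then [h1] vanishes on one set but not on the next; both measure the displacement of a
    nonzero entry. *)
Lemma kercoset_alg_indep (g : triple) : GL3 g -> exists f : 'I_2 -> triple -> K,
  (forall i, regular cc setT (f i)) /\ alg_indep (kercoset g) f.
Proof.
move=> [/unitmx_entry[[a b] /= ab] /unitmx_entry[[c e] /= ce] _].
pose D1 := [set h | exists2 mu : K, mu != 0 & h = scale3 1 mu mu^-1 g].
pose h2 (h : triple) := h.1.2 c e - g.1.2 c e.
pose h1 (h : triple) := h.1.1 a b - g.1.1 a b.
have rh1 : regular cc setT h1 by apply: regularB; [apply: regular_fst | apply: regular_cst].
have rh2 : regular cc setT h2 by apply: regularB; [apply: regular_snd | apply: regular_cst].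
have iD1 : irr_on cc D1.
  pose E := [set s : K | setT s /\ s != 0].
  have iE : irr_on (@line_coord K) E.
    by apply: irr_on_open; [apply: irr_on_line | apply: regular_line_id].
  have -> : D1 = (fun s => scale3 1 s s^-1 g) @` E.
    by apply/seteqP; split=> [_ [s s0 ->]|_ [s [_ s0] <-]]; exists s.
  apply: irr_on_image iE _.
  have rs f (A : 'M[K]_n.+1) : regular (@line_coord K) E f ->
      regular_mx (@line_coord K) E (fun v => f v *: A).
    move=> rf i j; apply: regular_ext (regularM rf (regular_cst _ _ (A i j))) => v _.
    by rewrite mxE.
  apply: regular_map_triple; apply: rs.
  - exact: regular_cst.
  - exact: regular_line_id.
  - by apply: regularV; [move=> s [] | apply: regular_line_id].
have two (x : K) : x != 0 -> 2%:R * x - x != 0.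
  by move=> x0; rewrite mulr_natl mulr2n addrK.
have g1 : scale3 1 1 1 g = g by rewrite /scale3 !scale1r; case: (g) => [[]].
exists (fcons h1 (fcons h2 (fun _ _ => 0))); split.
  by apply: regular_fcons => //; apply: regular_fcons => // -[].
apply: (alg_indep_cons (cc := cc) (D := D1)).
- move=> _ [mu mu0 ->]; exists 1, mu, mu^-1; split=> //.
  by rewrite mul1r divff.
- exact: irr_on_kercoset.
- by apply: regular_fcons => [|[]//]; apply: regular_sub rh2.
- exact: regular_sub rh1.
- by move=> _ [mu mu0 ->]; rewrite /h1 /= scale1r subrr.
- exists (scale3 2%:R 1 2%:R^-1 g); last by rewrite /h1 /= mxE two.
  by exists 2%:R, 1, 2%:R^-1; rewrite mulr1 divff // pnatr_eq0.
apply: (alg_indep_cons (cc := cc) (D := [set g])) => //.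
- by move=> _ ->; exists 1; rewrite ?oner_neq0 ?invr1 ?g1.
- by case.
- exact: regular_sub rh2.
- by move=> _ ->; rewrite /h2 subrr.
- exists (scale3 1 2%:R 2%:R^-1 g); last by rewrite /h2 /= mxE two.
  by exists 2%:R; rewrite ?pnatr_eq0.
exact: (alg_indep0 (x := g)).
Qed.

(** Two functions come from a single coset in the smallest member, and each strict inclusion adds an
    equation of the smaller member that fails at a point of the larger one; hence [d.+2]. *)
Lemma chain_alg_indep T d :
  irreducible_chain (@quotient_zariski_closed K n.+1) (symmetry_group T) d ->
  exists Z (f : 'I_d.+2 -> triple -> K),
    [/\ Z `<=` stabilizer T, irr_on cc Z, (forall i, regular cc Z (f i)) & alg_indep Z f].
Proof.
move=> [Z [Zc Zs]].
pose pre i := [set g : triple | GL3 g /\ Z i (kercoset g)].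
have ZY i : (i <= d)%N -> Z i `<=` symmetry_group T.
  by move=> /Zc [[F _ ->] _] c [].
have Zg i : (i <= d)%N -> forall c, Z i c -> exists2 g, GL3 g & c = kercoset g.
  by move=> id c /(ZY i id) [g [ug _] <-]; exists g.
have ipre i : (i <= d)%N -> irr_on cc (pre i).
  by move=> id; apply: irr_on_preimage (Zg i id) _; case: (Zc i id).
(* Keeping the functions regular on the whole space lets the same ones be used on every member of
   the chain. *)
suff: forall i, (i <= d)%N -> exists f : 'I_i.+2 -> triple -> K,
    (forall j, regular cc setT (f j)) /\ alg_indep (pre i) f.
  move=> /(_ d (leqnn d)) [f [rf li]]; exists (pre d), f; split=> //.
  - by move=> g [ug /(ZY d (leqnn d)) /(symmetry_groupP T ug) gT].
  - exact: ipre.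
  - by move=> j; apply: regular_sub (rf j).
elim=> [_|i IH id].
  have [_ [[c Zc0] _]] := Zc 0%N (leq0n d).
  have [g ug cE] := Zg 0%N (leq0n d) c Zc0.
  have [f [rf li]] := kercoset_alg_indep ug; exists f; split=> //.
  apply: alg_indep_sub li => h gh; split; first exact: kercoset_GL3 ug.
  by rewrite -(proj2 (kercoset_eqP g h) gh) -cE.
have [f [rf li]] := IH (ltnW id).
have [ZZ /existsNP [c /not_implyP [Zc1 Zc0]]] := Zs i id.
have [g ug cE] := Zg _ id c Zc1; rewrite {c}cE in Zc1 Zc0.
have [[F [S FS] ZE] _] := Zc i (ltnW id).
have Fg : ~ F (kercoset g).
  by move=> Fg; apply: Zc0; rewrite ZE; split=> //; apply: (ZY i.+1).
have /existsNP [p /not_implyP [Sp param_of]] : ~ forall p, S p -> p.@[cc g 0] = 0.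
  by move=> H; apply: Fg; apply/FS.
exists (fcons (fun h => p.@[cc h 0]) f); split.
  by apply: regular_fcons => //; apply: regular_mpoly.
apply: (alg_indep_cons (cc := cc)) li.
- by move=> h [uh /ZZ].
- exact: ipre.
- by move=> j; apply: regular_sub (rf j).
- exact: regular_mpoly.
- by move=> h [uh]; rewrite ZE => -[_ /(FS h uh)]; apply.
- by exists g => //; apply/eqP.
Qed.

End Chains.

(** * Tensors as bilinear maps *)

Section BilinearMap.
Variables (K : numFieldType) (m : nat).
Implicit Types (T : tensor K m) (x y : 'rV[K]_m) (g h : mx_triple K m).
Local Notation d_ i := (delta_mx 0 i : 'rV[K]_m).

Definition mu T x y : 'rV[K]_m := y *m contractA T x.

Lemma muE T x y k : mu T x y 0 k = \sum_j y 0 j * \sum_i x 0 i * T (i, j, k).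
Proof. by rewrite mxE; apply: eq_bigr => j _; rewrite mxE. Qed.

Lemma mu_contractB T x y : mu T x y = x *m contractB T y.
Proof.
apply/rowP => k; rewrite muE mxE.
under eq_bigr do rewrite mulr_sumr.
rewrite exchange_big; apply: eq_bigr => i _; rewrite mxE mulr_sumr.
by apply: eq_bigr => j _; rewrite mulrCA.
Qed.

Lemma muDr T x y y' : mu T x (y + y') = mu T x y + mu T x y'.
Proof. exact: mulmxDl. Qed.

Lemma muZr T x a y : mu T x (a *: y) = a *: mu T x y.
Proof. by rewrite /mu scalemxAl. Qed.

Lemma muDl T x x' y : mu T (x + x') y = mu T x y + mu T x' y.
Proof. by rewrite !mu_contractB mulmxDl. Qed.

Lemma muZl T x a y : mu T (a *: x) y = a *: mu T x y.
Proof. by rewrite !mu_contractB scalemxAl. Qed.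

Lemma mu_suml T I (r : seq I) (F : I -> 'rV[K]_m) y :
  mu T (\sum_(i <- r) F i) y = \sum_(i <- r) mu T (F i) y.
Proof.
by rewrite mu_contractB mulmx_suml; apply: eq_bigr => i _; rewrite mu_contractB.
Qed.

Lemma mu_sumr T I (r : seq I) (F : I -> 'rV[K]_m) x :
  mu T x (\sum_(i <- r) F i) = \sum_(i <- r) mu T x (F i).
Proof. by rewrite /mu mulmx_suml. Qed.

Lemma mu_delta T i j k : mu T (d_ i) (d_ j) 0 k = T (i, j, k).
Proof.
rewrite /mu -rowE !mxE (bigD1 i) //= !mxE !eqxx mul1r big1 ?addr0 // => i' /negPf ii'.
by rewrite mxE ii' andbF mul0r.
Qed.

Lemma mu_inj T T' : (forall i j, mu T (d_ i) (d_ j) = mu T' (d_ i) (d_ j)) -> T = T'.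
Proof. by move=> H; apply/ffunP => -[[i j] k]; rewrite -!mu_delta H. Qed.

Lemma act_delta g T i j :
  mu (act g T) (d_ i) (d_ j) = mu T (row i g.1.1) (row j g.1.2) *m g.2^T.
Proof.
apply/rowP => k; rewrite mu_delta ffunE mxE /=.
under [RHS]eq_bigr do rewrite muE mulr_suml.
rewrite exchange_big [RHS]exchange_big; apply: eq_bigr => j' _.
rewrite exchange_big; apply: eq_bigr => k' _.
rewrite mulr_sumr mulr_suml; apply: eq_bigr => i' _.
by rewrite !mxE; ring.
Qed.

(** This turns a stabilizing triple into an autotopism of [mu T]: the first two matrices act on the
    arguments, and the inverse transpose of the third is k. *)
Lemma mu_act g T x y : mu (act g T) x y = mu T (x *m g.1.1) (y *m g.1.2) *m g.2^T.
Proof.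
rewrite [x]row_sum_delta [y]row_sum_delta !mulmx_suml !mu_sumr mulmx_suml.
apply: eq_bigr => j _; rewrite !mu_suml mulmx_suml; apply: eq_bigr => i _.
by rewrite -!scalemxAl !muZl !muZr act_delta !rowE -!scalemxAl.
Qed.

Definition mul3 g h : mx_triple K m := (g.1.1 *m h.1.1, g.1.2 *m h.1.2, g.2 *m h.2).
Definition inv3 g : mx_triple K m := (invmx g.1.1, invmx g.1.2, invmx g.2).
Definition one3 : mx_triple K m := (1%:M, 1%:M, 1%:M).

Lemma act_mul3 g h T : act (mul3 g h) T = act g (act h T).
Proof. by apply: mu_inj => i j; rewrite !mu_act /= trmx_mul !mulmxA. Qed.

Lemma act_one3 T : act one3 T = T.
Proof. by apply: mu_inj => i j; rewrite mu_act /= trmx1 !mulmx1. Qed.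

Lemma mul3A f g h : mul3 f (mul3 g h) = mul3 (mul3 f g) h.
Proof. by rewrite /mul3 /= !mulmxA. Qed.

Lemma mul3_1l g : mul3 one3 g = g.
Proof. by rewrite /mul3 /= !mul1mx; case: g => [[]]. Qed.

Lemma mul3_1r g : mul3 g one3 = g.
Proof. by rewrite /mul3 /= !mulmx1; case: g => [[]]. Qed.

Lemma mul3V g : GL3 g -> mul3 g (inv3 g) = one3.
Proof. by move=> [u1 u2 u3]; rewrite /mul3 /= !mulmxV. Qed.

Lemma mul3Vl g : GL3 g -> mul3 (inv3 g) g = one3.
Proof. by move=> [u1 u2 u3]; rewrite /mul3 /= !mulVmx. Qed.

Lemma GL3_mul g h : GL3 g -> GL3 h -> GL3 (mul3 g h).
Proof. by move=> [u1 u2 u3] [v1 v2 v3]; split; rewrite /= unitmx_mul; apply/andP. Qed.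

Lemma GL3_inv g : GL3 g -> GL3 (inv3 g).
Proof. by move=> [u1 u2 u3]; split; rewrite /= unitmx_inv. Qed.

Lemma act_inv3 g T T' : GL3 g -> act g T = T' -> act (inv3 g) T' = T.
Proof. by move=> ug <-; rewrite -act_mul3 mul3Vl // act_one3. Qed.

Local Notation cc := (@coords K m).

Lemma regular_mul3 D h h' : regular_map cc cc D (fun g => mul3 h (mul3 g h')).
Proof.
apply: regular_map_triple => /=;
  apply: regular_mxM (regular_mx_cst _ _ _) (regular_mxM _ (regular_mx_cst _ _ _)).
- exact: regular_fst.
- exact: regular_snd.
- exact: regular_thd.
Qed.

(* The stabilizer has dimension at least d. *)
Definition indep_fun T d := exists Z (f : 'I_d -> mx_triple K m -> K),
  [/\ Z `<=` stabilizer T, irr_on cc Z, (forall i, regular cc Z (f i)) & alg_indep Z f].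

(** Serves for conjugation, translation and permutation of the factors: functions are pulled back
    along the left inverse [v], so their independence survives. *)
Lemma transfer T T' d Z (f : 'I_d -> mx_triple K m -> K) (u v : mx_triple K m -> mx_triple K m) :
  (forall g, GL3 g -> act g T = T -> GL3 (u g) /\ act (u g) T' = T') ->
  (forall g, v (u g) = g) ->
  regular_map cc cc setT u -> regular_map cc cc setT v ->
  Z `<=` stabilizer T -> irr_on cc Z -> (forall i, regular cc Z (f i)) -> alg_indep Z f ->
  [/\ u @` Z `<=` stabilizer T', irr_on cc (u @` Z),
      (forall i, regular cc (u @` Z) (fun g => f i (v g))) &
      alg_indep (u @` Z) (fun i g => f i (v g))].
Proof.
move=> Hu uK ru rv ZT iZ rf li; split.
- by move=> _ [g /ZT [ug gT] <-]; apply: Hu.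
- by apply: irr_on_image iZ _ => i; apply: regular_sub (ru i).
- move=> i; apply: (regular_comp (cc := cc) (D := Z)) => //.
    by move=> j; apply: regular_sub (rv j).
  by move=> _ [g Zg <-]; rewrite uK.
- apply: alg_indep_comp li => g Zg; exists (u g); last exact: uK.
  by exists g.
Qed.

Lemma indep_fun_act h T d : GL3 h -> indep_fun T d -> indep_fun (act h T) d.
Proof.
move=> uh [Z [f [ZT iZ rf li]]].
exists ((fun g => mul3 h (mul3 g (inv3 h))) @` Z), (fun i g => f i (mul3 (inv3 h) (mul3 g h))).
have [||||????] := transfer (T' := act h T) (u := fun g => mul3 h (mul3 g (inv3 h)))
  (v := fun g => mul3 (inv3 h) (mul3 g h)) _ _ _ _ ZT iZ rf li; last by split.
- move=> g ug gT; split; first by do 2?apply: GL3_mul => //; apply: GL3_inv.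
  by rewrite !act_mul3 (act_inv3 uh (erefl _)) gT.
- by move=> g; rewrite !mul3A mul3Vl // mul3_1l -mul3A mul3Vl // mul3_1r.
- exact: regular_mul3.
- exact: regular_mul3.
Qed.

(* Translating Z by the inverse of one of its points. *)
Lemma indep_fun_one T d : indep_fun T d -> exists Z (f : 'I_d -> mx_triple K m -> K),
  [/\ Z `<=` stabilizer T, irr_on cc Z, (forall i, regular cc Z (f i)) & alg_indep Z f] /\
  Z one3.
Proof.
move=> [Z [f [ZT iZ rf li]]]; have [z Zz] := alg_indep_neq0 li.
have [uz zT] := ZT z Zz.
exists ((fun g => mul3 (inv3 z) (mul3 g one3)) @` Z), (fun i g => f i (mul3 z (mul3 g one3))).
split; last by exists z; rewrite // mul3_1r mul3Vl.
apply: (transfer (T := T) (T' := T) (u := fun g => mul3 (inv3 z) (mul3 g one3))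
  (v := fun g => mul3 z (mul3 g one3))) => //.
- move=> g ug gT; rewrite mul3_1r; split; first by apply: GL3_mul => //; apply: GL3_inv.
  by rewrite act_mul3 gT; apply: act_inv3.
- by move=> g; rewrite !mul3_1r mul3A mul3V // mul3_1l.
- exact: regular_mul3.
- exact: regular_mul3.
Qed.

End BilinearMap.

(** * Normalizing a tensor to have a two-sided unit *)

Section Unital.
Variables (K : numFieldType) (n : nat).
Implicit Types (T : tensor K n.+1).
Local Notation d_ i := (delta_mx 0 i : 'rV[K]_n.+1).

(** Equivalently, e_0 is a two-sided unit for [mu T]. *)
Definition unital T := contractA T (d_ ord0) = 1%:M /\ contractB T (d_ ord0) = 1%:M.

Lemma row_ext (e : 'rV[K]_n.+1) : e != 0 -> exists2 P, P \in unitmx & row ord0 P = e.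
Proof.
move=> e0; have eE := mulmx_ebase e; rewrite (rank_rV e) e0 in eE.
have uc := col_ebase_unit e; pose c := col_ebase e 0 0.
have cE : col_ebase e = c%:M by rewrite [LHS]mx11_scalar.
have c0 : c != 0 by move: uc; rewrite cE unitmxE det_scalar1 unitfE.
exists (c *: row_ebase e); first by rewrite unitmxZ ?unitfE // row_ebase_unit.
rewrite -[RHS]eE cE mul_scalar_mx -scalemxAl linearZ /= rowE; congr (_ *: (_ *m _)).
by apply/rowP => -[[|j] jn]; rewrite !mxE.
Qed.

(** Kaplansky's trick: with L the left multiplication by u and R the right multiplication by v, both
    invertible, the product mu (x R^-1) (y L^-1) has the unit mu u v, which [P] moves to e_0. *)
Lemma unital_act T : genericA T -> genericB T -> exists2 h, GL3 h & unital (act h T).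
Proof.
move=> [u ru] [v rv].
have uL : contractA T u \in unitmx by rewrite -row_free_unit /row_free ru.
have uR : contractB T v \in unitmx by rewrite -row_free_unit /row_free rv.
set L := contractA T u in uL; set R := contractB T v in uR.
pose e := mu T u v.
have eR : e *m invmx R = u by rewrite /e mu_contractB mulmxK.
have eL : e *m invmx L = v by rewrite /e /mu mulmxK.
have e0 : e != 0.
  apply/eqP => e0; move: uL; rewrite /L -eR e0 mul0mx.
  suff -> : contractA T 0 = 0 by rewrite unitmxE det0 unitr0.
  by apply/matrixP => j k; rewrite !mxE big1 // => i _; rewrite mxE mul0r.
have [P uP Pe] := row_ext e0; rewrite rowE in Pe.
exists (P *m invmx R, P *m invmx L, (invmx P)^T).
  by split; rewrite /= ?unitmx_mul ?unitmx_inv ?unitmx_tr ?uP ?unitmx_inv.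
have ext (A : 'M[K]_n.+1) : (forall y : 'rV_n.+1, y *m A = y) -> A = 1%:M.
  by move=> H; apply/row_matrixP => i; rewrite !rowE H mulmx1.
split; apply: ext => y.
  rewrite -[LHS]/(mu _ _ y) mu_act /= trmxK !mulmxA Pe eR /mu -/L.
  by rewrite mulmxKV // mulmxK.
rewrite -mu_contractB mu_act /= trmxK !mulmxA Pe eL mu_contractB -/R.
by rewrite mulmxKV // mulmxK.
Qed.

Lemma mu_unitl T y : unital T -> mu T (d_ ord0) y = y.
Proof. by move=> [uT _]; rewrite /mu uT mulmx1. Qed.

Lemma mu_unitr T x : unital T -> mu T x (d_ ord0) = x.
Proof. by move=> [_ uT]; rewrite mu_contractB uT mulmx1. Qed.

End Unital.

(** * Parametrizing the stabilizer of a unital tensor *)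

Section UpperBound.
Variables (K : numFieldType) (n : nat) (T : tensor K n.+1).
Hypothesis uT : unital T.
Local Notation d_ i := (delta_mx 0 i : 'rV[K]_n.+1).
Local Notation li := (lift ord0).
Local Notation triple := (mx_triple K n.+1).
Local Notation cc := (@coords K n.+1).

Lemma addmxE p q (A B : 'M[K]_(p, q)) i j : (A + B) i j = A i j + B i j.
Proof. exact: mxE. Qed.

Lemma scalemxE p q a (A : 'M[K]_(p, q)) i j : (a *: A) i j = a * A i j.
Proof. exact: mxE. Qed.

Lemma row_mxE p q (A : 'M[K]_(p, q)) i j k : row i A j k = A i k.
Proof. exact: mxE. Qed.

(* (a, b, w), where w_i is stored without its vanishing first coordinate. *)
Definition param := ('rV[K]_n.+1 * 'rV[K]_n.+1 * 'M[K]_n)%type.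
Definition pcoords (x : param) : 'rV[K]_(n.+1 + n.+1 + n * n) :=
  row_mx (row_mx x.1.1 x.1.2) (mxvec x.2).
Implicit Types (x : param) (g : triple).

Lemma irr_on_param : irr_on pcoords setT.
Proof.
apply: (@irr_on_space _ _ _ _
  (fun v => (lsubmx (lsubmx v), rsubmx (lsubmx v), vec_mx (rsubmx v)))).
- by move=> [[a b] M]; rewrite /pcoords /= !row_mxKl !row_mxKr mxvecK.
- by move=> v; rewrite /pcoords /= vec_mxK !hsubmxK.
Qed.

Lemma regular_param1 E : regular_mx pcoords E (fun x => x.1.1).
Proof.
move=> i j; rewrite ord1.
by apply: regular_ext (regular_coord _ _ (lshift _ (lshift _ j))) => x _;
   rewrite /pcoords !row_mxEl.
Qed.

Lemma regular_param2 E : regular_mx pcoords E (fun x => x.1.2).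
Proof.
move=> i j; rewrite ord1.
by apply: regular_ext (regular_coord _ _ (lshift _ (rshift _ j))) => x _;
   rewrite /pcoords row_mxEl row_mxEr.
Qed.

Lemma regular_param3 E : regular_mx pcoords E (fun x => x.2).
Proof.
move=> i j.
by apply: regular_ext (regular_coord _ _ (rshift _ (mxvec_index i j))) => x _;
   rewrite /pcoords row_mxEr mxvecE.
Qed.

Definition mulA x := contractA T x.1.1.
Definition mulB x := contractB T x.1.2.
Definition isotope_unit x := mu T x.1.1 x.1.2.
(* The isotope of T whose unit is [isotope_unit x]. *)
Definition isotope x p q := mu T (p *m invmx (mulB x)) (q *m invmx (mulA x)).
Definition kappa_mod x (i : 'I_n) : 'rV[K]_n.+1 :=
  \row_c (if unlift ord0 c is Some j then x.2 i j else 0).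
Lemma kappa_mod_ord0 x i : kappa_mod x i 0 ord0 = 0.
Proof. by rewrite mxE unlift_none. Qed.

Lemma kappa_mod_lift x i j : kappa_mod x i 0 (li j) = x.2 i j.
Proof. by rewrite mxE liftK. Qed.

(** For nondegenerate [x], the projection along [isotope_unit x] onto the hyperplane where
    coordinate [ord0] vanishes. *)
Definition proj x (p : 'rV[K]_n.+1) c :=
  p 0 c - p 0 ord0 / isotope_unit x 0 ord0 * isotope_unit x 0 c.
(* The coefficient of [isotope_unit x] in kappa (e_i), solved from the i-th coordinate
   of kappa (mu e_i e_i) = isotope (kappa e_i) (kappa e_i) modulo [isotope_unit x]. *)
Definition lam x i : K :=
  (\sum_k T (li i, li i, li k) * x.2 k i
    - proj x (isotope x (kappa_mod x i) (kappa_mod x i)) (li i))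
  / (2%:R * x.2 i i).
(** The matrix of k: its rows are the images e of e_0 and w_i + lam_i e of the other basis
    vectors. *)
Definition kappa x : 'M[K]_n.+1 := \matrix_(r, c)
  (if unlift ord0 r is Some i then kappa_mod x i 0 c + lam x i * isotope_unit x 0 c
   else isotope_unit x 0 c).

Lemma kappa_ord0 x c : kappa x ord0 c = isotope_unit x 0 c.
Proof. by rewrite [LHS]mxE unlift_none. Qed.

Lemma kappa_lift x i c : kappa x (li i) c = kappa_mod x i 0 c + lam x i * isotope_unit x 0 c.
Proof. by rewrite [LHS]mxE liftK. Qed.

(** The locus where all denominators in [isotope], [lam] and [kappa] are nonzero. *)
Definition nondeg : set param := [set x |
  [/\ isotope_unit x 0 ord0 != 0, mulA x \in unitmx, mulB x \in unitmx & forall i, x.2 i i != 0]].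

Lemma regular_mu (X : Type) N (dd : X -> 'rV[K]_N) D (F G : X -> 'rV[K]_n.+1) :
  regular_mx dd D F -> regular_mx dd D G ->
  regular_mx dd D (fun z => mu T (F z) (G z)).
Proof.
move=> rF rG i k; rewrite ord1.
have : regular dd D (fun z => \sum_j G z 0 j * \sum_i F z 0 i * T (i, j, k)).
  apply: regular_sum => j _; apply: regularM => //; apply: regular_sum => l _.
  by apply: regularM => //; apply: regular_cst.
by apply: regular_ext => z _; rewrite muE.
Qed.

Lemma regular_contractA (X : Type) N (dd : X -> 'rV[K]_N) D (F : X -> 'rV[K]_n.+1) :
  regular_mx dd D F -> regular_mx dd D (fun z => contractA T (F z)).
Proof.
move=> rF j k; have : regular dd D (fun z => \sum_i F z 0 i * T (i, j, k)).
  by apply: regular_sum => l _; apply: regularM => //; apply: regular_cst.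
by apply: regular_ext => z _; rewrite mxE.
Qed.

Lemma regular_contractB (X : Type) N (dd : X -> 'rV[K]_N) D (F : X -> 'rV[K]_n.+1) :
  regular_mx dd D F -> regular_mx dd D (fun z => contractB T (F z)).
Proof.
move=> rF j k; have : regular dd D (fun z => \sum_i F z 0 i * T (j, i, k)).
  by apply: regular_sum => l _; apply: regularM => //; apply: regular_cst.
by apply: regular_ext => z _; rewrite mxE.
Qed.

Lemma regular_mulA D : regular_mx pcoords D mulA.
Proof. exact: regular_contractA (regular_param1 _). Qed.

Lemma regular_mulB D : regular_mx pcoords D mulB.
Proof. exact: regular_contractB (regular_param2 _). Qed.

Lemma regular_isotope_unit D : regular_mx pcoords D isotope_unit.
Proof. exact: regular_mu (regular_param1 _) (regular_param2 _). Qed.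

Lemma regular_iLa : regular_mx pcoords nondeg (fun x => invmx (mulA x)).
Proof. by apply: regular_invmx; [move=> x [] | apply: regular_mulA]. Qed.

Lemma regular_iRb : regular_mx pcoords nondeg (fun x => invmx (mulB x)).
Proof. by apply: regular_invmx; [move=> x [] | apply: regular_mulB]. Qed.

Lemma regular_isotope F G : regular_mx pcoords nondeg F -> regular_mx pcoords nondeg G ->
  regular_mx pcoords nondeg (fun x => isotope x (F x) (G x)).
Proof.
move=> rF rG; apply: regular_mu; apply: regular_mxM => //.
- exact: regular_iRb.
- exact: regular_iLa.
Qed.

Lemma regular_kappa_mod i : regular_mx pcoords nondeg (fun x => kappa_mod x i).
Proof.
move=> r c; rewrite ord1; case: (unliftP ord0 c) => [j|] cE.
  by apply: regular_ext (regular_param3 _ i j) => x _; rewrite cE kappa_mod_lift.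
by apply: regular_ext (regular_cst _ _ 0) => x _; rewrite cE kappa_mod_ord0.
Qed.

Lemma regular_lam i : regular pcoords nondeg (fun x => lam x i).
Proof.
apply: regularM; last first.
  apply: regularV => [x [_ _ _ /(_ i) M0]|]; first by rewrite mulf_neq0 ?pnatr_eq0.
  by apply: regularM; [apply: regular_cst | apply: regular_param3].
apply: regularB.
  apply: regular_sum => k _; apply: regularM; first exact: regular_cst.
  exact: regular_param3.
have ri := regular_isotope (regular_kappa_mod i) (regular_kappa_mod i).
apply: regularB; first exact: ri.
apply: regularM; last exact: regular_isotope_unit.
apply: regularM; first exact: ri.
by apply: regularV; [move=> x [] | apply: regular_isotope_unit].
Qed.

Lemma regular_kappa : regular_mx pcoords nondeg kappa.
Proof.
move=> r c; case: (unliftP ord0 r) => [i|] rE; last first.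
  by apply: regular_ext (regular_isotope_unit _ 0 c) => x _; rewrite rE kappa_ord0.
apply: (@regular_ext _ _ _ _ _ (fun x => kappa_mod x i 0 c + lam x i * isotope_unit x 0 c)).
  by move=> x _; rewrite rE kappa_lift.
apply: regularD; first exact: regular_kappa_mod.
by apply: regularM; [apply: regular_lam | apply: regular_isotope_unit].
Qed.

Lemma mu_delta_row i j (A : 'M[K]_n.+1) c :
  (mu T (d_ i) (d_ j) *m A) 0 c = \sum_l T (i, j, l) * A l c.
Proof. by rewrite mxE; apply: eq_bigr => l _; rewrite mu_delta. Qed.

(** On the stabilizer this is k, because k x = k (mu x e_0) = mu (g x) (h e_0). *)
Definition kappa_of g : 'M[K]_n.+1 := g.1.1 *m contractB T (row ord0 g.1.2).
Definition unit_of g := mu T (row ord0 g.1.1) (row ord0 g.1.2).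
Definition param_of g : param := (row ord0 g.1.1, row ord0 g.1.2,
  \matrix_(i, j) (kappa_of g (li i) (li j)
    - kappa_of g (li i) ord0 / unit_of g 0 ord0 * unit_of g 0 (li j))).
(** Denominators are cleared, so that nonvanishing is an open condition on triples. On the
    stabilizer the remaining conditions of [nondeg] are automatic. *)
Definition nondeg_fun g : K := unit_of g 0 ord0 * \prod_i
  (kappa_of g (li i) (li i) * unit_of g 0 ord0 - kappa_of g (li i) ord0 * unit_of g 0 (li i)).

Lemma regular_nondeg_fun D : regular cc D nondeg_fun.
Proof.
have rrow (F : triple -> 'M[K]_n.+1) : regular_mx cc D F ->
    regular_mx cc D (fun g => row ord0 (F g)).
  by move=> rF i j; apply: regular_ext (rF ord0 j) => g _; rewrite mxE.
have re : regular_mx cc D unit_of.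
  by apply: regular_mu; apply: rrow; [apply: regular_fst | apply: regular_snd].
have rk : regular_mx cc D kappa_of.
  apply: regular_mxM; first exact: regular_fst.
  by apply: regular_contractB; apply: rrow; apply: regular_snd.
apply: regularM; first exact: re.
by apply: regular_prod => i _; apply: regularB; apply: regularM => //; apply: re.
Qed.

(** At the identity, e = e_0 and w_i = e_i. A family of stabilizing triples translated to contain
    the identity therefore has a nonempty nondegenerate part. *)
Lemma nondeg_fun_one : nondeg_fun (one3 K n.+1) != 0.
Proof.
have r1 : row ord0 1%:M = d_ ord0 by rewrite rowE mulmx1.
have k1 : kappa_of (one3 K n.+1) = 1%:M.
  by rewrite /kappa_of /= mul1mx r1; case: uT.
rewrite /nondeg_fun k1 /unit_of /= r1 mu_unitl // mxE /= mul1r big1 ?oner_neq0 // => i _.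
by rewrite !mxE !eqxx /= mulr1 mul0r subr0.
Qed.

(** Putting y = e_0 or x = e_0 in k (mu x y) = mu (g x) (h y) expresses k as g followed by right
    multiplication by b, or h followed by left multiplication by a. So a, b and k determine the
    triple. *)
Lemma stab_kappa_of g : stabilizer T g ->
  [/\ mulA (param_of g) \in unitmx, mulB (param_of g) \in unitmx, kappa_of g \in unitmx,
      g = (kappa_of g *m invmx (mulB (param_of g)), kappa_of g *m invmx (mulA (param_of g)),
           (invmx (kappa_of g))^T)
    & forall p q, mu T (p *m g.1.1) (q *m g.1.2) = mu T p q *m kappa_of g].
Proof.
move=> [[u1 u2 u3] gT].
have kmu p q : mu T (p *m g.1.1) (q *m g.1.2) = mu T p q *m invmx g.2^T.
  by rewrite -{2}gT mu_act mulmxK // unitmx_tr.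
have ext (A B : 'M[K]_n.+1) : (forall y : 'rV_n.+1, y *m A = y *m B) -> A = B.
  by move=> H; apply/row_matrixP => i; rewrite !rowE H.
have kE : kappa_of g = invmx g.2^T.
  by apply: ext => y; rewrite mulmxA -mu_contractB rowE kmu mu_unitr.
have kE' : g.1.2 *m mulA (param_of g) = kappa_of g.
  by apply: ext => y; rewrite mulmxA kE /mulA /= rowE -[LHS]/(mu _ _ _) kmu mu_unitl.
have uk : kappa_of g \in unitmx by rewrite kE unitmx_inv unitmx_tr.
have uR : mulB (param_of g) \in unitmx by move: uk; rewrite /kappa_of unitmx_mul => /andP[].
have uL : mulA (param_of g) \in unitmx by move: uk; rewrite -kE' unitmx_mul => /andP[].
split=> //; last by move=> p q; rewrite kE.
have -> : kappa_of g *m invmx (mulB (param_of g)) = g.1.1 by rewrite mulmxK.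
have -> : kappa_of g *m invmx (mulA (param_of g)) = g.1.2 by rewrite -kE' mulmxK.
rewrite kE invmxK trmxK.
by case: g {gT u1 u2 u3 kmu kE kE' uk uR uL} => [[]].
Qed.

Lemma param_of_nondeg g : stabilizer T g -> nondeg_fun g != 0 -> nondeg (param_of g).
Proof.
move=> /stab_kappa_of [uL uR _ _ _]; rewrite /nondeg_fun mulf_eq0 negb_or.
move=> /andP[e0 /prodf_neq0 H].
split; [exact: e0 | exact: uL | exact: uR | move=> i].
have := H i isT.
apply: contraNneq; rewrite /= mxE => /(congr1 ( *%R^~ (unit_of g 0 ord0))).
by rewrite mul0r mulrBl mulrAC divfK // => ->.
Qed.

(** The failure of [kappa x] to carry the product of T to its isotope on two basis vectors other
    than e_0. *)
Definition mult_rel x i j c : K :=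
  isotope x (row (li i) (kappa x)) (row (li j) (kappa x)) 0 c
  - \sum_l T (li i, li j, l) * kappa x l c.

Lemma regular_mult_rel i j c : regular pcoords nondeg (fun x => mult_rel x i j c).
Proof.
have rr r : regular_mx pcoords nondeg (fun x => row r (kappa x)).
  by move=> k l; apply: regular_ext (regular_kappa r l) => x _; rewrite [RHS]mxE.
apply: regularB; first exact: (regular_isotope (rr _) (rr _)).
apply: regular_sum => l _; apply: regularM; first exact: regular_cst.
exact: regular_kappa.
Qed.

Lemma isotopeDl x p p' q : isotope x (p + p') q = isotope x p q + isotope x p' q.
Proof. by rewrite /isotope mulmxDl muDl. Qed.
Lemma isotopeDr x p q q' : isotope x p (q + q') = isotope x p q + isotope x p q'.
Proof. by rewrite /isotope mulmxDl muDr. Qed.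
Lemma isotopeZl x a p q : isotope x (a *: p) q = a *: isotope x p q.
Proof. by rewrite /isotope -scalemxAl muZl. Qed.
Lemma isotopeZr x a p q : isotope x p (a *: q) = a *: isotope x p q.
Proof. by rewrite /isotope -scalemxAl muZr. Qed.

Lemma isotope_unitl x q : mulA x \in unitmx -> mulB x \in unitmx -> isotope x (isotope_unit x) q = q.
Proof.
move=> uL uR; rewrite /isotope (_ : isotope_unit x *m _ = x.1.1) ?[LHS]mulmxKV //.
by rewrite /isotope_unit mu_contractB mulmxK.
Qed.

Lemma isotope_unitr x q : mulA x \in unitmx -> mulB x \in unitmx -> isotope x q (isotope_unit x) = q.
Proof.
move=> uL uR; rewrite /isotope mu_contractB (_ : isotope_unit x *m _ = x.1.2) ?mulmxKV //.
by rewrite /isotope_unit /mu mulmxK.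
Qed.

(** The true coefficients [l i] must agree with [lam]. In the relation for the square of a basis
    vector, the square of [l i] and the combination [L] of all the [l k] enter only as multiples of
    e, so projecting along e leaves a linear equation with coefficient 2 w_ii. *)
Lemma kappa_param_of g : stabilizer T g -> nondeg_fun g != 0 -> kappa (param_of g) = kappa_of g.
Proof.
move=> gT h0; have [e0 uL uR M0] := param_of_nondeg gT h0.
have [_ _ uk gE kmu] := stab_kappa_of gT.
set x := param_of g in e0 uL uR M0 gE *.
have kiso p q : isotope x (p *m kappa_of g) (q *m kappa_of g) = mu T p q *m kappa_of g.
  by rewrite -kmu {3 4}gE /isotope -!mulmxA.
have eE : row ord0 (kappa_of g) = isotope_unit x.
  by rewrite rowE -[d_ _](mu_unitl _ uT) -kmu -!rowE.
pose l i := kappa_of g (li i) ord0 / isotope_unit x 0 ord0.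
have xM i j : x.2 i j = kappa_of g (li i) (li j) - kappa_of g (li i) ord0 / isotope_unit x 0 ord0 * isotope_unit x 0 (li j).
  by rewrite [LHS]mxE.
have kE i : row (li i) (kappa_of g) = kappa_mod x i + l i *: isotope_unit x.
  apply/rowP => c; rewrite row_mxE addmxE scalemxE.
  case: (unliftP ord0 c) => [j|] ->; last by rewrite kappa_mod_ord0 /l add0r divfK.
  by rewrite kappa_mod_lift xM /l subrK.
have lE i : lam x i = l i.
  have := kiso (d_ (li i)) (d_ (li i)); rewrite -!rowE kE.
  rewrite isotopeDl !isotopeDr !isotopeZl !isotopeZr isotope_unitl // isotope_unitl // isotope_unitr //.
  set W := isotope x (kappa_mod x i) (kappa_mod x i) => /rowP WE.
  have Wc c : W 0 c = \sum_k T (li i, li i, k) * kappa_of g k c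
       - l i * kappa_mod x i 0 c - l i * kappa_mod x i 0 c - l i * l i * isotope_unit x 0 c.
    have := WE c; rewrite mu_delta_row => <-.
    by rewrite !(addmxE, scalemxE); ring.
  have k0 c : kappa_of g ord0 c = isotope_unit x 0 c by rewrite -eE row_mxE.
  have kl j c : kappa_of g (li j) c = kappa_mod x j 0 c + l j * isotope_unit x 0 c.
    by have /rowP/(_ c) := kE j; rewrite row_mxE addmxE scalemxE.
  pose t0 := T (li i, li i, ord0); pose t k := T (li i, li i, li k).
  pose S := \sum_k t k * x.2 k i; pose L := \sum_k t k * l k.
  (* Coordinate [ord0] sees only the multiples of e, since the w_k vanish there; the same multiple
     recurs in [W1] and is removed by [proj]. *)
  have W0 : W 0 ord0 = (t0 + L - l i * l i) * isotope_unit x 0 ord0.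
    rewrite Wc kappa_mod_ord0 big_ord_recl k0 (_ : \sum_i0 _ = L * isotope_unit x 0 ord0); first by rewrite /t0; ring.
    by rewrite mulr_suml; apply: eq_bigr => k _; rewrite kl kappa_mod_ord0 add0r mulrA.
  have W1 : W 0 (li i) = (t0 + L - l i * l i) * isotope_unit x 0 (li i) + S - 2%:R * l i * x.2 i i.
    rewrite Wc kappa_mod_lift big_ord_recl k0 (_ : \sum_i0 _ = S + L * isotope_unit x 0 (li i)); first by rewrite /t0; ring.
    rewrite mulr_suml -big_split; apply: eq_bigr => k _.
    by rewrite kl kappa_mod_lift mulrDr mulrA.
  have Mi := M0 i; rewrite /lam /proj -/W W0 W1 -/S mulfK //.
  by field; rewrite Mi.
apply/matrixP => r c; case: (unliftP ord0 r) => [i|] ->.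
  by rewrite kappa_lift lE -[RHS](row_mxE _ _ 0) kE addmxE scalemxE.
by rewrite kappa_ord0 -[RHS](row_mxE _ _ 0) eE.
Qed.

Lemma mult_rel_param_of g i j c : stabilizer T g -> nondeg_fun g != 0 -> mult_rel (param_of g) i j c = 0.
Proof.
move=> gT h0; rewrite /mult_rel kappa_param_of //; have [_ _ _ gE kmu] := stab_kappa_of gT.
rewrite -mu_delta_row -kmu !rowE /isotope.
have g1 v : v *m kappa_of g *m invmx (mulB (param_of g)) = v *m g.1.1 by rewrite {3}gE /= mulmxA.
have g2 v : v *m kappa_of g *m invmx (mulA (param_of g)) = v *m g.1.2 by rewrite {3}gE /= mulmxA.
by rewrite g1 g2 subrr.
Qed.

(** The form of a triple found in [stab_kappa_of]; on the nondegenerate stabilizer it inverts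
    [param_of]. *)
Definition triple_of x : triple :=
  (kappa x *m invmx (mulB x), kappa x *m invmx (mulA x), (invmx (kappa x))^T).

(** Since [triple_of] is rational on [nondeg] and recovers the triple, functions composed with it
    stay regular and independent in the parameters. *)
Lemma indep_fun_param d : indep_fun T d -> exists (D : set param) (f : 'I_d -> param -> K),
  [/\ D `<=` nondeg, (forall x i j c, D x -> mult_rel x i j c = 0),
      (forall i, regular pcoords D (f i)) & alg_indep D f].
Proof.
move=> /indep_fun_one [Z [f [[ZT iZ rf lif] Z1]]].
pose Z' := [set g | Z g /\ nondeg_fun g != 0].
have li' : alg_indep Z' f.
  apply: (alg_indep_open iZ rf (regular_nondeg_fun _)) => //.
  by exists (one3 K n.+1) => //; apply: nondeg_fun_one.
have gxE g : Z' g -> triple_of (param_of g) = g.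
  by move=> [/ZT gT h0]; rewrite /triple_of kappa_param_of //; have [_ _ _ <- _] := stab_kappa_of gT.
pose D := param_of @` Z'.
have Dn : D `<=` nondeg by move=> _ [g [/ZT gT h0] <-]; apply: param_of_nondeg.
exists D, (fun i x => f i (triple_of x)); split=> //.
- by move=> _ i j c [g [/ZT gT h0] <-]; apply: mult_rel_param_of.
- move=> i; apply: (regular_comp (cc := cc) (D := Z)) => //; last first.
    by move=> _ [g Zg <-]; rewrite gxE //; case: Zg.
  have rs p q (F : param -> 'M[K]_(p, q)) :
      regular_mx pcoords nondeg F -> regular_mx pcoords D F.
    by move=> rF k l; apply: regular_sub (rF k l).
  apply: regular_map_triple => /=.
  + by apply: rs; apply: regular_mxM; [apply: regular_kappa | apply: regular_iRb].
  + by apply: rs; apply: regular_mxM; [apply: regular_kappa | apply: regular_iLa].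
  + apply: regular_tr; apply: regular_invmx; last by apply: rs; apply: regular_kappa.
    move=> _ [g [/ZT gT h0] <-]; rewrite kappa_param_of //.
    by have [] := stab_kappa_of gT.
- apply: alg_indep_comp li' => g Zg; exists (param_of g); last exact: gxE.
  by exists g.
Qed.

Lemma indep_fun_leq d : indep_fun T d -> (d <= n.+1 + n.+1 + n * n)%N.
Proof. by move=> /indep_fun_param [D [f [_ _ rf]]]; apply: alg_indep_leq. Qed.

(* In the extremal case the parameters are dense, so the relations can be
   specialized at the scalar matrix 2. *)
Lemma indep_fun_eq : indep_fun T (n.+1 + n.+1 + n * n) ->
  forall x i j c, nondeg x -> mult_rel x i j c = 0.
Proof.
move=> /indep_fun_param [D [f [Dn Drel rf lif]]] x i j c nx.
have [p [q pq]] := regular_mult_rel i j c.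
have [_ ->] := pq x nx.
(* The numerator of the relation is defined for all parameters and vanishes on [D], hence
   everywhere. *)
rewrite (alg_indep_dense (h := fun x => p.@[pcoords x 0]) irr_on_param rf lif) ?mul0r //.
  exact: regular_mpoly.
move=> z Dz; have [q0 /esym/eqP] := pq z (Dn z Dz).
by rewrite Drel // mulf_eq0 invr_eq0 (negPf q0) orbF => /eqP.
Qed.

End UpperBound.

(** * The tensor [T_utriv] as an algebra *)

Section Utriv.
Variables (K : numFieldType) (n : nat).
Local Notation d_ i := (delta_mx 0 i : 'rV[K]_n.+1).
Local Notation li := (lift ord0).
Local Notation triv := (T_utriv K n).

Lemma utrivE i j k : triv (i, j, k) =
  if i == ord0 then (j == k)%:R else if j == ord0 then (i == k)%:R else 0.
Proof.
have nz (r : 'I_n.+1) : (r != ord0) -> (ord0 == r) = false.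
  by rewrite eq_sym => /negPf.
rewrite /T_utriv !ffunE !sum_ffunE !xpair_eqE.
under eq_bigr do rewrite ffunE !xpair_eqE.
under [X in _ + X]eq_bigr do rewrite ffunE !xpair_eqE.
case: (eqVneq i ord0) => [->|i0] /=.
  rewrite [X in _ + X]big1 ?addr0 => [|r /nz ->//].
  case: (eqVneq j ord0) => [->|j0] /=.
    by rewrite big1 ?addr0 => [|r /nz ->//]; rewrite eq_sym.
  rewrite add0r (bigD1 j) //= eqxx big1 ?addr0 1?eq_sym // => r /andP[_ /negPf rj].
  by rewrite eq_sym rj.
rewrite !big1_eq !add0r; case: (eqVneq j ord0) => [_|_] /=; last first.
  by rewrite big1 // => r _; rewrite andbF.
rewrite (bigD1 i) //= eqxx big1 ?addr0 1?eq_sym // => r /andP[_ /negPf ri].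
by rewrite [i == r]eq_sym ri.
Qed.

Lemma utriv_unital : unital triv.
Proof.
split; apply/matrixP => j k; rewrite mxE (bigD1 ord0) //= !mxE eqxx mul1r utrivE /=.
  by rewrite big1 ?addr0 // => i /negPf i0; rewrite mxE i0 mul0r.
rewrite big1 ?addr0 => [|i /negPf i0]; last by rewrite mxE i0 mul0r.
by case: eqVneq => [->|] //; rewrite eq_sym.
Qed.

Lemma utriv_binding : binding triv.
Proof.
have [uA uB] := utriv_unital.
by apply: Or31; split; exists (d_ ord0); rewrite ?uA ?uB mxrank1.
Qed.

Lemma mu_utriv_lift i j : mu triv (d_ (li i)) (d_ (li j)) = 0.
Proof. by apply/rowP => k; rewrite mu_delta utrivE mxE. Qed.

(** [T_utriv] is the unital algebra K e_0 + V in which all products in V are zero, V being spanned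
    by the other basis vectors. *)
Lemma mu_utriv (x y : 'rV[K]_n.+1) : mu triv x y =
  x 0 ord0 *: y + y 0 ord0 *: x - (x 0 ord0 * y 0 ord0) *: d_ ord0.
Proof.
have dec (z : 'rV[K]_n.+1) : z = z 0 ord0 *: d_ ord0 + \sum_i z 0 (li i) *: d_ (li i).
  by rewrite {1}[z]row_sum_delta big_ord_recl.
pose z' (z : 'rV[K]_n.+1) := \sum_i z 0 (li i) *: d_ (li i).
have zz : mu triv (z' x) (z' y) = 0.
  rewrite mu_suml big1 // => i _; rewrite mu_sumr big1 // => j _.
  by rewrite muZl muZr mu_utriv_lift !scaler0.
have zE : z' x = x - x 0 ord0 *: d_ ord0 by rewrite {2}[x]dec addrC addKr.
rewrite {1}[x]dec muDl muZl mu_unitl; last exact: utriv_unital.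
rewrite {2}[y]dec muDr muZr mu_unitr ?zz ?addr0 -/(z' x); last exact: utriv_unital.
by rewrite zE scalerBr scalerA [y 0 _ * _]mulrC addrA.
Qed.

End Utriv.

(** * Identifying the extremal tensor *)

Section Extremal.
Variables (K : numFieldType) (n : nat) (T : tensor K n.+1).
Hypothesis uT : unital T.
Local Notation d_ i := (delta_mx 0 i : 'rV[K]_n.+1).
Local Notation li := (lift ord0).

(** By unitality the hypothesis says that the vectors e_i + l_i e_0 with i >= 1 have zero products;
    [P] is the base change to them and e_0. *)
Lemma isomorphic_utriv (l : 'I_n -> K) :
  (forall i j, mu T (d_ (li i)) (d_ (li j)) =
     - (l j *: d_ (li i) + l i *: d_ (li j) + (l i * l j) *: d_ ord0)) ->
  isomorphic T (T_utriv K n).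
Proof.
move=> H.
pose N : 'M[K]_n.+1 := \matrix_(r, c)
  (if unlift ord0 r is Some i then l i * (c == ord0)%:R else 0).
have N0 : row ord0 N = 0 by apply/rowP => c; rewrite !mxE unlift_none.
have Nl i : row (li i) N = l i *: d_ ord0.
  by apply/rowP => c; rewrite !mxE liftK.
have NN : N *m N = 0.
  apply/row_matrixP => r; rewrite row_mul row0; case: (unliftP ord0 r) => [i|] ->.
    by rewrite Nl -scalemxAl -rowE N0 scaler0.
  by rewrite N0 mul0mx.
pose P := 1%:M + N.
have uP : P \in unitmx.
  have /mulmx1_unit[] // : P *m (1%:M - N) = 1%:M.
  by rewrite mulmxDl !mulmxBr !mulmx1 NN mul1mx subr0 subrK.
have P0 : row ord0 P = d_ ord0 by rewrite linearD /= N0 addr0 rowE mulmx1.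
have Pl i : row (li i) P = d_ (li i) + l i *: d_ ord0.
  by rewrite linearD /= Nl rowE mulmx1.
exists (P, P, (invmx P)^T); first by split; rewrite /= ?unitmx_tr ?unitmx_inv.
apply: mu_inj => i j; rewrite mu_act /= trmxK -!rowE.
have uU := utriv_unital K n.
case: (unliftP ord0 i) => [i'|] ->; last first.
  by rewrite P0 !mu_unitl // rowE mulmxK.
case: (unliftP ord0 j) => [j'|] ->; last first.
  by rewrite P0 !mu_unitr // rowE mulmxK.
rewrite mu_utriv_lift !Pl muDl !muDr !muZl !muZr !mu_unitl // mu_unitr // H.
rewrite -scalerDr (_ : _ + _ = 0) ?mul0mx //; apply/rowP => c; rewrite !mxE; ring.
Qed.

Lemma extremal_utriv :
  indep_fun T (n.+1 + n.+1 + n * n) -> isomorphic T (T_utriv K n).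
Proof.
move=> /indep_fun_eq - /(_ uT) R.
(* Here the isotope is [mu T] itself and k e_i = 2 e_i + l_i e_0. The quadratic side of the
   relations multiplies the coefficients of T by 4, the linear side by 2 in V and by 1 along e_0. So
   they determine T after division by 2 and by 3, whereas the scalar 1 would cancel T. *)
pose x : param K n := (d_ ord0, d_ ord0, 2%:R%:M).
have Lx : mulA T x = 1%:M by case: uT.
have Rx : mulB T x = 1%:M by case: uT.
have ex : isotope_unit T x = d_ ord0 by rewrite /isotope_unit mu_unitl.
have nx : nondeg T x.
  split; rewrite ?Lx ?Rx ?unitmx1 //; first by rewrite ex mxE /= oner_neq0.
  by move=> i; rewrite mxE eqxx pnatr_eq0.
pose l := lam T x.
have two : 2%:R != 0 :> K by rewrite pnatr_eq0.
have kl i c : kappa T x (li i) c = 2%:R * (li i == c)%:R + l i * (c == ord0)%:R.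
  have d0 : d_ ord0 0 c = (c == ord0)%:R by rewrite mxE.
  rewrite kappa_lift ex d0; congr (_ + _).
  case: (unliftP ord0 c) => [j|] ->; rewrite ?kappa_mod_lift ?kappa_mod_ord0 ?mulr0 //=.
  by rewrite mxE (inj_eq lift_inj) mulr_natr.
have kr i : row (li i) (kappa T x) = 2%:R *: d_ (li i) + l i *: d_ ord0.
  by apply/rowP => c; rewrite row_mxE kl !mxE /= [c == li i]eq_sym.
have isoE p q : isotope T x p q = mu T p q by rewrite /isotope Lx Rx invmx1 !mulmx1.
have rel1 i j c : 4%:R * T (li i, li j, c) + 2%:R * l j * (li i == c)%:R
    + 2%:R * l i * (li j == c)%:R + l i * l j * (c == ord0)%:R
    = T (li i, li j, ord0) * (c == ord0)%:R
    + \sum_k T (li i, li j, li k) * (2%:R * (li k == c)%:R + l k * (c == ord0)%:R).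
  have /subr0_eq := R x i j c nx; rewrite isoE !kr muDl !muDr !muZl !muZr mu_unitl //.
  rewrite mu_unitr // mu_unitl // !(addmxE, scalemxE) mu_delta big_ord_recl kappa_ord0 ex.
  under eq_bigr do rewrite kl.
  rewrite !mxE /= ![c == li _]eq_sym => <-; ring.
have Tl i j r : T (li i, li j, li r) = - (l j * (i == r)%:R + l i * (j == r)%:R).
  have := rel1 i j (li r); rewrite !(inj_eq lift_inj) /= !mulr0 add0r addr0.
  under eq_bigr do rewrite mulr0 addr0 (inj_eq lift_inj).
  rewrite (bigD1 r) //= eqxx mulr1 big1 ?addr0 => [E|k /negPf ->]; last by rewrite !mulr0.
  apply: (mulIf two); apply/eqP; rewrite -subr_eq0; apply/eqP.
  move/eqP: E; rewrite -subr_eq0 => /eqP <-; ring.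
have T0 i j : T (li i, li j, ord0) = - (l i * l j).
  have := rel1 i j ord0; rewrite !mulr0 !addr0 !mulr1.
  under eq_bigr do rewrite mulr0 add0r mulr1 Tl.
  have -> : \sum_k - (l j * (i == k)%:R + l i * (j == k)%:R) * l k = - 2%:R * (l i * l j).
    under eq_bigr do rewrite mulNr mulrDl.
    rewrite sumrN big_split (bigD1 i) //= (bigD1 j (F := fun k => _ * (j == k)%:R * l k)) //=.
    rewrite !eqxx !big1 => [|k kj|k ki]; first by rewrite /=; ring.
    - by rewrite eq_sym (negPf kj) mulr0 mul0r.
    - by rewrite eq_sym (negPf ki) mulr0 mul0r.
  move=> E; have three : 3%:R != 0 :> K by rewrite pnatr_eq0.
  apply: (mulIf three); apply/eqP; rewrite -subr_eq0; apply/eqP.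
  move/eqP: E; rewrite -subr_eq0 => /eqP <-; ring.
apply: (isomorphic_utriv (l := l)) => i j; apply/rowP => c; rewrite mu_delta.
case: (unliftP ord0 c) => [r|] ->; rewrite ?Tl ?T0 !mxE /=.
  by rewrite !(inj_eq lift_inj) mulr0 addr0 ![r == _]eq_sym.
by rewrite !mulr0 !add0r mulr1.
Qed.

End Extremal.

(** * Permutation of the factors *)

Section Permutations.
Implicit Type s t : 'S_3.
Local Notation o1 := (Ordinal (isT : (1 < 3)%N)).

Definition tup3 (X : Type) (x : X * X * X) := [tuple x.1.1; x.1.2; x.2].

(** Matches the reindexing in [permute_factors], and applies equally to triples of indices and of
    matrices. *)
Definition perm3 (X : Type) s (x : X * X * X) : X * X * X :=
  (tnth (tup3 x) (s ord0), tnth (tup3 x) (s o1), tnth (tup3 x) (s ord_max)).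

Lemma ord3P (P : 'I_3 -> Prop) : P ord0 -> P o1 -> P ord_max -> forall r, P r.
Proof.
move=> P0 P1 P2 [[|[|[|//]]] H].
- by rewrite (_ : Ordinal H = ord0) //; apply: val_inj.
- by rewrite (_ : Ordinal H = o1) //; apply: val_inj.
- by rewrite (_ : Ordinal H = ord_max) //; apply: val_inj.
Qed.

Lemma tnth_perm3 X s (x : X * X * X) r : tnth (tup3 (perm3 s x)) r = tnth (tup3 x) (s r).
Proof. by move: r; apply: ord3P. Qed.

Lemma tup3_inj X (x y : X * X * X) : (forall r, tnth (tup3 x) r = tnth (tup3 y) r) -> x = y.
Proof.
case: x y => [[a b] c] [[a' b'] c'] H.
by have := H ord0; have := H o1; have := H ord_max; rewrite !(tnth_nth a) /= => -> -> ->.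
Qed.

Lemma perm3K X s : cancel (@perm3 X s) (perm3 s^-1%g).
Proof. by move=> x; apply: tup3_inj => r; rewrite !tnth_perm3 permKV. Qed.

Lemma perm3KV X s : cancel (@perm3 X s^-1%g) (perm3 s).
Proof. by move=> x; apply: tup3_inj => r; rewrite !tnth_perm3 permK. Qed.

Variables (K : numFieldType) (m : nat).
Local Notation triple := (mx_triple K m).
Local Notation cc := (@coords K m).
Implicit Types (g h : triple) (T : tensor K m).

Lemma prod_perm3 s (F : 'I_3 -> K) : \prod_r F (s r) = \prod_r F r.
Proof. by rewrite [RHS](reindex_inj (@perm_inj _ s)). Qed.

Lemma prod_ord3 (F : 'I_3 -> K) : \prod_r F r = F ord0 * F o1 * F ord_max.
Proof.
rewrite !big_ord_recl big_ord0 mulr1 mulrA.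
by congr (_ * F _ * F _); apply: val_inj.
Qed.

Lemma act_sum g T x : act g T x =
  \sum_(w : 'I_m * 'I_m * 'I_m)
     (\prod_r (tnth (tup3 g) r) (tnth (tup3 x) r) (tnth (tup3 w) r)) * T w.
Proof.
rewrite ffunE pair_big pair_big; apply: eq_bigr => -[[i j] k] _ /=.
by rewrite prod_ord3.
Qed.

(** With the action written as a sum over index triples of products over three factors, both sides
    agree after reindexing by [perm3 s] and permuting those products. *)
Lemma act_perm3 s g T :
  act (perm3 s^-1%g g) (permute_factors s T) = permute_factors s (act g T).
Proof.
apply/ffunP => x; rewrite [RHS]ffunE -[RHS]/(act g T (perm3 s x)) !act_sum.
rewrite [RHS](reindex (perm3 s)) /=; last first.
  by exists (perm3 s^-1%g) => w _; rewrite ?perm3K ?perm3KV.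
apply: eq_bigr => w _; rewrite ffunE; congr (_ * _).
rewrite -(prod_perm3 s); apply: eq_bigr => r _.
by rewrite !tnth_perm3 permK.
Qed.

Lemma GL3P g : GL3 g <-> forall r, tnth (tup3 g) r \in unitmx.
Proof.
split=> [[u1 u2 u3]|H]; first by apply: ord3P.
by split; [exact: (H ord0) | exact: (H o1) | exact: (H ord_max)].
Qed.

Lemma GL3_perm3 s g : GL3 g -> GL3 (perm3 s g).
Proof. by move=> /GL3P H; apply/GL3P => r; rewrite tnth_perm3. Qed.

Lemma regular_perm3 s D : regular_map cc cc D (perm3 s).
Proof.
have H r : regular_mx cc D (fun g => tnth (tup3 g) r).
  move: r; apply: ord3P; [exact: regular_fst | exact: regular_snd | exact: regular_thd].
by apply: regular_map_triple; apply: H.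
Qed.

Lemma kercosetP g h : kercoset g h <-> exists2 c : 'I_3 -> K, \prod_r c r = 1 &
  forall r, tnth (tup3 h) r = c r *: tnth (tup3 g) r.
Proof.
split=> [[l [mu [nu [e ->]]]]|[c c1 H]].
  exists (tnth (tup3 (l, mu, nu))); first by rewrite prod_ord3.
  by apply: ord3P.
exists (c ord0), (c o1), (c ord_max); split; first by rewrite -prod_ord3.
by apply: tup3_inj; apply: ord3P; rewrite H.
Qed.

Lemma kercoset_perm3 s g h : kercoset g h -> kercoset (perm3 s g) (perm3 s h).
Proof.
move=> /kercosetP [c c1 H]; apply/kercosetP; exists (fun r => c (s r)).
  by rewrite prod_perm3.
by move=> r; rewrite !tnth_perm3 H.
Qed.

Lemma kercoset_mul3 f f' g h :
  kercoset g h -> kercoset (mul3 f (mul3 g f')) (mul3 f (mul3 h f')).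
Proof.
move=> [l [mu [nu [e ->]]]]; exists l, mu, nu; split=> //.
by rewrite /mul3 /= -!scalemxAl -!scalemxAr.
Qed.

Lemma indep_fun_perm s T d : indep_fun T d -> indep_fun (permute_factors s T) d.
Proof.
move=> [Z [f [ZT iZ rf li]]].
have [||||????] := transfer (T' := permute_factors s T) (u := perm3 s^-1%g)
  (v := perm3 s) _ _ _ _ ZT iZ rf li.
- by move=> g ug gT; split; [apply: GL3_perm3 | rewrite act_perm3 gT].
- exact: perm3KV.
- exact: regular_perm3.
- exact: regular_perm3.
- by exists (perm3 s^-1%g @` Z), (fun i g => f i (perm3 s g)); split.
Qed.

End Permutations.

(** * Chains from rational families *)

Section LowerBound.
Variables (K : numFieldType) (n N : nat) (T : tensor K n.+1).
Local Notation triple := (mx_triple K n.+1).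
Local Notation cc := (@coords K n.+1).
Local Notation tc := (fun t : 'rV[K]_N => t).
(** [phi] is a family of stabilizing triples over the open set where [q] is nonzero. The [rho i]
    detect only whether t_i vanishes, which is unaffected when the kernel rescales a triple. *)
Variables (phi : 'rV[K]_N -> triple) (q : 'rV[K]_N -> K) (rho : 'I_N -> triple -> K).
Hypotheses (rq : regular tc setT q) (q0 : q 0 != 0).
Hypothesis rphi : regular_map cc tc [set t | q t != 0] phi.
Hypothesis phiT : forall t, q t != 0 -> stabilizer T (phi t).
Hypothesis rrho : forall i, regular cc setT (rho i).
Hypothesis rho0 : forall i t h, q t != 0 -> kercoset (phi t) h ->
  rho i h = 0 <-> t 0 i = 0.

Let U i := [set t : 'rV[K]_N | q t != 0 /\ forall r : 'I_N, (i <= r)%N -> t 0 r = 0].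

Let regular_line (t u : 'rV[K]_N) D : regular_map tc (@line_coord K) D (fun s => t + s *: u).
Proof.
move=> i; have := regularD (regular_cst (@line_coord K) D (t 0 i))
  (regularM (regular_line_id D) (regular_cst (@line_coord K) D (u 0 i))).
by apply: regular_ext => s _; rewrite !mxE.
Qed.

Let regular_qline t u D : regular (@line_coord K) D (fun s => q (t + s *: u)).
Proof. by apply: (regular_comp (cc := tc) (D := setT)) => //; apply: regular_line. Qed.

Let irrU i : irr_on tc (U i).
Proof.
apply: irr_on_curves => t t' [qt t0] [qt' t0'].
exists (fun s => t + s *: (t' - t)), (fun s => q (t + s *: (t' - t))), 0, 1; split.
- by rewrite scale0r addr0 scale1r addrC subrK.
- by rewrite scale0r addr0 scale1r addrC subrK.
- exact: regular_qline.
- by move=> s qs; split=> // r ir; rewrite !mxE t0 // t0' // subrr mulr0 addr0.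
- exact: regular_line.
Qed.

Let irr_on_phiU i : irr_on cc (phi @` U i).
Proof.
apply: (irr_on_image (dd := tc)) => [|j]; first exact: irrU.
by apply: regular_sub (rphi j) => t [].
Qed.

Let I i := [set p : {mpoly K[_]} |
  forall t h, U i t -> kercoset (phi t) h -> p.@[cc h 0] = 0].

Let F i : set (set triple) := [set c |
  forall g, GL3 g -> c = kercoset g -> forall p, I i p -> p.@[cc g 0] = 0].

Let F_closed i : quotient_zariski_closed (F i).
Proof.
exists (I i) => g ug; split=> [Fg p|H g' ug' /kercoset_eqP [l [mu [nu [e ->]]]] p Ip].
  exact: Fg.
have [P HP] := scale3_mpoly l mu nu p; apply/HP/H => t h Ut th; apply/HP.
by apply: (Ip t) => //; apply: kercoset_trans th _; exists l, mu, nu.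
Qed.

Let Z i := symmetry_group T `&` F i.

Let Z_phi i t : U i t -> Z i (kercoset (phi t)).
Proof.
move=> Ut; have [ut tT] := phiT (proj1 Ut); split; first by apply/symmetry_groupP.
by move=> g _ /kercoset_eqP tg p; apply; [apply: Ut | ].
Qed.

Let U0 i : U i 0.
Proof. by split=> // r _; rewrite mxE. Qed.

(** By [side], a closed set containing the image of [U i] contains [Z i], so irreducibility can be
    tested on that image. *)
Let Z_irr_on i : irreducible (@quotient_zariski_closed K n.+1) (Z i).
Proof.
split; first by exists (kercoset (phi 0)); apply: Z_phi.
have side F1 : quotient_zariski_closed F1 ->
    (forall t, U i t -> F1 (kercoset (phi t))) -> Z i `<=` F1.
  move=> [S HS] HU c [[g [ug gT] <-] Fc]; apply/HS => // p Sp; apply: Fc => // t h Ut th.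
  have [ut _] := phiT (proj1 Ut); have uh := kercoset_GL3 th ut.
  have := HU t Ut; have -> : kercoset (phi t) = kercoset h by apply/kercoset_eqP.
  by move=> /(HS h uh); apply.
move=> F1 F2 c1 c2 ZF.
have [H1|/existsNP [t1 /not_implyP [Ut1 nF1]]] :=
  pselect (forall t, U i t -> F1 (kercoset (phi t))); first by left; apply: side.
have [H2|/existsNP [t2 /not_implyP [Ut2 nF2]]] :=
  pselect (forall t, U i t -> F2 (kercoset (phi t))); first by right; apply: side.
exfalso; case: c1 => S1 HS1; case: c2 => S2 HS2.
have u_ t (Ut : U i t) : GL3 (phi t) by case: (phiT (proj1 Ut)).
have /existsNP [p1 /not_implyP [Sp1 p1t]] : ~ forall p, S1 p -> p.@[cc (phi t1) 0] = 0.
  by move=> /HS1 - /(_ (u_ _ Ut1)).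
have /existsNP [p2 /not_implyP [Sp2 p2t]] : ~ forall p, S2 p -> p.@[cc (phi t2) 0] = 0.
  by move=> /HS2 - /(_ (u_ _ Ut2)).
have [_ [t Ut <-]|p10|p20] := irr_on_phiU (i := i) (p := p1) (q := p2).
- case: (ZF _ (Z_phi Ut)) => [/HS1 - /(_ (u_ _ Ut) p1 Sp1) ->|/HS2 - /(_ (u_ _ Ut) p2 Sp2) ->].
    by rewrite mul0r.
  by rewrite mulr0.
- by apply: p1t; apply: p10; exists t1.
- by apply: p2t; apply: p20; exists t2.
Qed.

(* The closures of the images of the coordinate subspaces {t_r = 0, r >= i} form
   the chain; rho i vanishes on the i-th closure but not on the next one. *)
Lemma chain_of_family : irreducible_chain (@quotient_zariski_closed K n.+1) (symmetry_group T) N.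
Proof.
exists Z; split=> [i _|i iN].
  by split; [exists (F i) => //; apply: F_closed | apply: Z_irr_on].
split=> [c [Yc Fc]|ZZ].
  split=> // g ug cg p Ip; apply: Fc ug cg _ _ => t h [qt Ut]; apply: Ip.
  by split=> // r ir; apply: Ut; apply: ltnW.
pose o := Ordinal iN; pose d := delta_mx 0 o : 'rV[K]_N.
(* Neither [q] along the axis [d] nor s itself is identically zero, and the line is irreducible. *)
have [s qs s0] : exists2 s, q (0 + s *: d) != 0 & s != 0.
  apply: contrapT => H.
  have [||s _|/(_ 0 Logic.I)/eqP|/(_ 1 Logic.I)/eqP] := irr_on_regular (@irr_on_line K)
     (f := fun s => q (0 + s *: d)) (g := id).
  - exact: regular_qline.
  - exact: regular_line_id.
  - apply/eqP; rewrite mulf_eq0 -implyNb; apply/implyP => qs.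
    by apply/negPn/negP => s0; apply: H; exists s.
  - by rewrite scale0r addr0 (negPf q0).
  - by rewrite oner_eq0.
rewrite add0r in qs.
have Us : U i.+1 (s *: d).
  split=> // r ir; rewrite !mxE [r == o](_ : _ = false) ?mulr0 //.
  by apply/negP => /eqP ro; rewrite ro ltnn in ir.
have [_ Fs] := ZZ _ (Z_phi Us).
have [us _] := phiT qs.
have [P [Q H]] := rrho o.
(* The numerator of [rho o] vanishes on all cosets coming from [U i]. If the next member were
   contained in [Z i], it would vanish at this point as well, although s is nonzero. *)
have /(rho0 o qs (kercoset_refl _)) : rho o (phi (s *: d)) = 0.
  have [_ ->] := H (phi (s *: d)) Logic.I; rewrite (Fs _ us (erefl _)) ?mul0r // => t h [qt Ut] th.
  have [Q0 rE] := H h Logic.I; have : rho o h = 0 by apply/(rho0 o qt th)/Ut.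
  by rewrite rE => /eqP; rewrite mulf_eq0 invr_eq0 (negPf Q0) orbF => /eqP.
by rewrite !mxE !eqxx mulr1 => /eqP; apply/negP.
Qed.

End LowerBound.

(** * An explicit family stabilizing [T_utriv] *)

Section UtrivFamily.
Variables (K : numFieldType) (n : nat).
Local Notation N := (n + n + n * n)%N.
Local Notation triple := (mx_triple K n.+1).
Local Notation cc := (@coords K n.+1).
Local Notation tc := (fun t : 'rV[K]_N => t).
Local Notation d0 := (delta_mx 0 ord0 : 'rV[K]_n.+1).
Implicit Types (a b : 'rV[K]_n) (M : 'M[K]_n) (x y : 'rV[K]_n.+1) (t : 'rV[K]_N).

(** On row vectors it sends e_0 to e_0 + a and acts by M on V. *)
Definition ublock a M : 'M[K]_n.+1 := block_mx (1%:M : 'M_1) a 0 M.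

Lemma det_ublock1 a M : \det (ublock a M) = \det M.
Proof. by rewrite /ublock (det_ublock (n1 := 1)) det1 mul1r. Qed.

Lemma mul_row_ublock (p : 'M[K]_1) u a M :
  row_mx p u *m ublock a M = row_mx p (p *m a + u *m M) :> 'rV[K]_n.+1.
Proof.
have := mul_row_block p u 1%:M a 0 M; rewrite mulmx1 mulmx0 addr0; exact.
Qed.

Lemma add_row_ublock (p q : 'M[K]_1) u b :
  row_mx p u + row_mx q b = row_mx (p + q) (u + b) :> 'rV[K]_n.+1.
Proof. exact: (add_row_mx p u q b). Qed.

Lemma row_split0 x : x = row_mx (x 0 ord0)%:M (rsubmx (x : 'rV_(1 + n))) :> 'rV[K]_n.+1.
Proof.
have <- : lsubmx (x : 'rV_(1 + n)) = (x 0 ord0)%:M.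
  by rewrite [LHS]mx11_scalar mxE; congr (x 0 _)%:M; apply: val_inj.
by rewrite [RHS](hsubmxK (x : 'rV_(1 + n))).
Qed.

Lemma row_mx_entry0 (p : 'M[K]_1) u : (row_mx p u : 'rV[K]_n.+1) 0 ord0 = p 0 0.
Proof.
by rewrite -(row_mxEl p u); congr (_ 0 _); apply: val_inj.
Qed.

Lemma ublock_entry0 x a M : (x *m ublock a M) 0 ord0 = x 0 ord0.
Proof. by rewrite [x in LHS]row_split0 mul_row_ublock row_mx_entry0 mxE eqxx mulr1n. Qed.

Lemma ublockD x a b M :
  x *m ublock (a + b) M = x *m ublock a M + x 0 ord0 *: (row_mx (0 : 'M_1) b : 'rV[K]_n.+1).
Proof.
rewrite {1 2}[x]row_split0 !mul_row_ublock mulmxDr !mul_scalar_mx.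
have := scale_row_mx (x 0 ord0) (0 : 'M_1) b => /= ->.
by rewrite scaler0 add_row_ublock addr0 addrAC.
Qed.

Lemma ublock_delta a M : d0 *m ublock a M = d0 + row_mx (0 : 'M_1) a.
Proof.
have dE : d0 = row_mx (1%:M : 'M_1) 0.
  have d00 : d0 0 ord0 = 1 by rewrite mxE eqxx.
  have dr : rsubmx (d0 : 'rV_(1 + n)) = 0 by apply/rowP => j; rewrite !mxE.
  by rewrite [LHS]row_split0 d00 dr.
by rewrite dE mul_row_ublock mul1mx mul0mx addr0 add_row_ublock addr0 add0r.
Qed.

Definition tA t : 'rV[K]_n := lsubmx (lsubmx t).
Definition tB t : 'rV[K]_n := rsubmx (lsubmx t).
Definition tM t : 'M[K]_n := vec_mx (rsubmx t).
(** As products in V vanish, (e_0 + a) (e_0 + b) = e_0 + a + b, which dictates k and so the third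
    matrix. The shift by [1%:M] puts the identity at t = 0. *)
Definition utriv_fam t : triple :=
  (ublock (tA t) (1%:M + tM t), ublock (tB t) (1%:M + tM t),
   (invmx (ublock (tA t + tB t) (1%:M + tM t)))^T).
Definition utriv_det t : K := \det (1%:M + tM t).
(** Reads off a, b and M - 1 homogeneously: the corner entry, equal to 1 in the family, replaces the
    constant 1, so the kernel multiplies each value by a nonzero scalar. *)
Definition utriv_coord (i : 'I_N) (g : triple) : K :=
  (row_mx (row_mx (ursubmx (g.1.1 : 'M_(1 + n))) (ursubmx (g.1.2 : 'M_(1 + n))))
    (mxvec (drsubmx (g.1.1 : 'M_(1 + n)) - (ulsubmx (g.1.1 : 'M_(1 + n)) 0 0)%:M))) 0 i.

Lemma utriv_fam_stabilizer t : utriv_det t != 0 -> stabilizer (T_utriv K n) (utriv_fam t).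
Proof.
move=> q0; have u a : ublock a (1%:M + tM t) \in unitmx.
  by rewrite unitmxE det_ublock1 unitfE.
split; first by split; rewrite /= ?unitmx_tr ?unitmx_inv.
apply: mu_inj => i j; rewrite mu_act /= trmxK; apply: (canLR (mulmxK (u _))).
move: (delta_mx 0 i) (delta_mx 0 j) => x y.
rewrite !mu_utriv !ublock_entry0 mulmxBl mulmxDl -!scalemxAl ublock_delta.
have -> : y *m ublock (tA t + tB t) (1%:M + tM t) =
    y *m ublock (tB t) (1%:M + tM t) + y 0 ord0 *: row_mx (0 : 'M_1) (tA t).
  by rewrite addrC ublockD.
rewrite ublockD.
have -> : row_mx (0 : 'M_1) (tA t + tB t) =
    row_mx (0 : 'M_1) (tA t) + row_mx (0 : 'M_1) (tB t) :> 'rV[K]_n.+1.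
  by rewrite add_row_ublock addr0.
have oppmxE (z : 'rV[K]_n.+1) c : (- z) 0 c = - z 0 c by rewrite mxE.
by apply/rowP => c; rewrite !(addmxE, scalemxE, oppmxE); ring.
Qed.

Lemma regular_tA D : regular_mx tc D tA.
Proof.
move=> i j; rewrite ord1; apply: regular_ext (regular_coord tc _ (lshift _ (lshift _ j))) => t _.
by rewrite !mxE.
Qed.

Lemma regular_tB D : regular_mx tc D tB.
Proof.
move=> i j; rewrite ord1; apply: regular_ext (regular_coord tc _ (lshift _ (rshift _ j))) => t _.
by rewrite !mxE.
Qed.

Lemma regular_tM D : regular_mx tc D (fun t => 1%:M + tM t).
Proof.
move=> i j; have := regularD (regular_cst tc D ((1%:M : 'M_n) i j))
  (regular_coord tc D (rshift _ (mxvec_index i j))).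
by apply: regular_ext => t _; rewrite !mxE.
Qed.

Lemma regular_ublock D (A : 'rV[K]_N -> 'rV[K]_n) (M : 'rV[K]_N -> 'M[K]_n) :
  regular_mx tc D A -> regular_mx tc D M -> regular_mx tc D (fun t => ublock (A t) (M t)).
Proof.
move=> rA rM i j; rewrite /ublock.
case: (@split_ordP 1 n i) => i' ->; case: (@split_ordP 1 n j) => j' ->.
- apply: regular_ext (regular_cst _ _ ((1%:M : 'M_1) i' j')) => t _.
  exact/esym/(block_mxEul (1%:M : 'M_1) (A t) 0 (M t)).
- apply: regular_ext (rA i' j') => t _.
  exact/esym/(block_mxEur (1%:M : 'M_1) (A t) 0 (M t)).
- apply: regular_ext (regular_cst _ _ ((0 : 'M_(n, 1)) i' j')) => t _.
  exact/esym/(block_mxEdl (1%:M : 'M_1) (A t) 0 (M t)).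
- apply: regular_ext (rM i' j') => t _.
  exact/esym/(block_mxEdr (1%:M : 'M_1) (A t) 0 (M t)).
Qed.

Lemma regular_utriv_fam : regular_map cc tc [set t | utriv_det t != 0] utriv_fam.
Proof.
apply: regular_map_triple => /=.
- by apply: regular_ublock; [apply: regular_tA | apply: regular_tM].
- by apply: regular_ublock; [apply: regular_tB | apply: regular_tM].
apply: regular_tr; apply: regular_invmx => [t q0|].
  by rewrite unitmxE det_ublock1 unitfE.
apply: regular_ublock; last exact: regular_tM.
move=> i j; apply: regular_ext (regularD (regular_tA _ i j) (regular_tB _ i j)) => t _.
by rewrite addmxE.
Qed.

Lemma regular_utriv_coord i D : regular cc D (utriv_coord i).
Proof.
rewrite /utriv_coord; case: (split_ordP i) => [i' ->|k ->]; last first.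
  case/mxvec_indexP: k => r c.
  have r1 := @regular_fst K n.+1 D.
  have := regularB (r1 (@rshift 1 n r) (@rshift 1 n c))
    (regularM (r1 (@lshift 1 n 0) (@lshift 1 n 0)) (regular_cst cc D (r == c)%:R)).
  apply: regular_ext => g _; rewrite row_mxEr mxvecE !mxE.
  by case: eqP => _; rewrite ?mulr1 ?mulr0.
case: (split_ordP i') => j ->.
  apply: regular_ext (@regular_fst K n.+1 D (@lshift 1 n 0) (@rshift 1 n j)) => g _.
  by rewrite !row_mxEl !mxE.
apply: regular_ext (@regular_snd K n.+1 D (@lshift 1 n 0) (@rshift 1 n j)) => g _.
by rewrite row_mxEl row_mxEr !mxE.
Qed.

Lemma utriv_coord_eq0 i t h : kercoset (utriv_fam t) h -> utriv_coord i h = 0 <-> t 0 i = 0.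
Proof.
move=> [l [mu [nu [e ->]]]].
have : l * mu * nu != 0 by rewrite e oner_neq0.
rewrite !mulf_eq0 !negb_or => /andP[/andP[l0 mu0] _].
have scale_ub c a M : c *: ublock a M =
    block_mx (c *: (1%:M : 'M_1)) (c *: a) (c *: 0) (c *: M).
  exact: (scale_block_mx c (1%:M : 'M_1)).
rewrite /utriv_coord /= !scale_ub !block_mxKur block_mxKdr block_mxKul.
have tE : t = row_mx (row_mx (tA t) (tB t)) (mxvec (tM t)).
  by rewrite /tM vec_mxK !hsubmxK.
have mulI0 (c z : K) : c != 0 -> c * z = 0 <-> z = 0.
  by move=> c0; split=> [/eqP|->]; rewrite ?mulr0 // mulf_eq0 (negPf c0) => /eqP.
rewrite {4}tE; case: (split_ordP i) => [i' ->|k ->]; last first.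
  case/mxvec_indexP: k => r c; rewrite !row_mxEr !mxvecE -[X in _ <-> X](mulI0 l) //.
  by rewrite !mxE mulr1n; case: eqP => _ /=; rewrite ?mulr1n ?mulr0n ?add0r ?subr0 //;
     rewrite mulrDr mulr1 addrAC subrr add0r.
case: (split_ordP i') => j ->; rewrite !row_mxEl ?row_mxEl ?row_mxEr scalemxE; exact: mulI0.
Qed.

End UtrivFamily.

(** * The bound and the equality case *)

Section Main.
Variables (K : numFieldType) (n : nat).
Implicit Type T : tensor K n.+1.
Local Notation o1 := (Ordinal (isT : (1 < 3)%N)).

Lemma permute_factorsK s T : permute_factors s^-1%g (permute_factors s T) = T.
Proof.
apply/ffunP => x; rewrite ffunE -[LHS]/(permute_factors s T (perm3 s^-1%g x)) ffunE.
by rewrite -[LHS]/(T (perm3 s (perm3 s^-1%g x))) perm3KV.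
Qed.

(** [th] carries the family for [T_utriv] to the stabilizer of [T], and [ht] carries it back to
    where the coordinates are read off. *)
Lemma utriv_chain s T : isomorphic (permute_factors s T) (T_utriv K n) ->
  irreducible_chain (@quotient_zariski_closed K n.+1) (symmetry_group T) (n + n + n * n).
Proof.
move=> [h uh hT]; pose th g := perm3 s (mul3 (inv3 h) (mul3 g h)).
pose ht g := mul3 h (mul3 (perm3 s^-1%g g) (inv3 h)).
have thK g : ht (th g) = g.
  by rewrite /ht /th perm3K !mul3A mul3V // mul3_1l -mul3A mul3V // mul3_1r.
apply: (chain_of_family (phi := fun t => th (utriv_fam t)) (q := @utriv_det K n)
  (rho := fun i g => utriv_coord i (ht g))).
- by apply: regular_det; apply: regular_tM.
- rewrite /utriv_det (_ : tM 0 = 0) ?addr0 ?det1 ?oner_neq0 //.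
  by rewrite /tM !linear0.
- have rth : regular_map (@coords K n.+1) (@coords K n.+1) setT th.
    move=> i; apply: (regular_comp (cc := @coords K n.+1) (D := setT)
      (u := fun g => mul3 (inv3 h) (mul3 g h)) (f := fun g => coords (perm3 s g) 0 i)) => //.
      exact: regular_mul3.
    exact: regular_perm3.
  move=> i; apply: (regular_comp (cc := @coords K n.+1) (D := setT)
    (f := fun g => coords (th g) 0 i)) => //.
  exact: regular_utriv_fam.
- move=> t /utriv_fam_stabilizer [ug gT].
  have u' : GL3 (mul3 (inv3 h) (mul3 (utriv_fam t) h)).
    by apply: GL3_mul; [apply: GL3_inv | apply: GL3_mul].
  split; first exact: GL3_perm3.
  have := act_perm3 s^-1%g (mul3 (inv3 h) (mul3 (utriv_fam t) h)) (permute_factors s T).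
  rewrite invgK permute_factorsK => ->.
  by rewrite !act_mul3 hT gT (act_inv3 uh hT) permute_factorsK.
- move=> i; apply: (regular_comp (cc := @coords K n.+1) (D := setT)) => //; last first.
    exact: regular_utriv_coord.
  move=> j; apply: (regular_comp (cc := @coords K n.+1) (D := setT)
    (f := fun g => coords (mul3 h (mul3 g (inv3 h))) 0 j)) => //.
    exact: regular_perm3.
  exact: regular_mul3.
- move=> i t g _ tg; apply: utriv_coord_eq0; rewrite -[utriv_fam t]thK.
  by apply: kercoset_mul3; apply: kercoset_perm3.
Qed.

(** A transposition moves the factor whose genericity is not given to the third place. *)
Lemma binding_permute T : binding T -> exists s : 'S_3,
  genericA (permute_factors s T) /\ genericB (permute_factors s T).
Proof.
have tpE i j r : tperm i j r = if r == i then j else if r == j then i else r :> 'I_3.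
  by rewrite permE.
have pE s i j k : permute_factors s T (i, j, k) = T (perm3 s (i, j, k)) by rewrite ffunE.
have E12 i j k : permute_factors (tperm o1 ord_max) T (i, j, k) = T (i, k, j).
  by rewrite pE /perm3 !tpE.
have E02 i j k : permute_factors (tperm ord0 ord_max) T (i, j, k) = T (k, j, i).
  by rewrite pE /perm3 !tpE.
case=> [[gA gB]|[[u uA] [v vC]]|[[v vB] [u uC]]].
- exists 1%g; suff -> : permute_factors 1 T = T by [].
  by apply/ffunP => -[[i j] k]; rewrite pE /perm3 !perm1.
- exists (tperm o1 ord_max); split; [exists u | exists v].
    (* Swapping the last two indices transposes the contraction, which keeps its rank. *)
    rewrite -[RHS]uA -mxrank_tr; congr (\rank _); apply/matrixP => j k.
    by rewrite !mxE; apply: eq_bigr => i _; rewrite E12.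
  rewrite -[RHS]vC; congr (\rank _); apply/matrixP => j k.
  by rewrite !mxE; apply: eq_bigr => i _; rewrite E12.
- exists (tperm ord0 ord_max); split; [exists u | exists v].
    rewrite -[RHS]uC -mxrank_tr; congr (\rank _); apply/matrixP => j k.
    by rewrite !mxE; apply: eq_bigr => i _; rewrite E02.
  rewrite -[RHS]vB -mxrank_tr; congr (\rank _); apply/matrixP => j k.
  by rewrite !mxE; apply: eq_bigr => i _; rewrite E02.
Qed.

Lemma binding_unital T d : binding T ->
  irreducible_chain (@quotient_zariski_closed K n.+1) (symmetry_group T) d ->
  exists s h, [/\ GL3 h, unital (act h (permute_factors s T))
    & indep_fun (act h (permute_factors s T)) d.+2].
Proof.
move=> /binding_permute [s [gA gB]] /chain_alg_indep iT.
have [h uh hu] := unital_act gA gB; exists s, h; split=> //.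
by apply: indep_fun_act => //; apply: indep_fun_perm.
Qed.

Lemma binding_dim_le T : binding T -> dim_symmetry_le T (n.+1 ^ 2 - 1).
Proof.
move=> bT d /(binding_unital bT) [s [h [_ uT]]] /(indep_fun_leq uT).
(* With m = [n.+1], the bound reads d + 2 <= 2 m + (m - 1)^2 = m^2 + 1. *)
by rewrite -mulnn; lia.
Qed.

Lemma binding_dim_eq T : binding T ->
  dim_symmetry_eq T (n.+1 ^ 2 - 1) <->
  exists s : 'S_3, isomorphic (permute_factors s T) (T_utriv K n).
Proof.
move=> bT; split=> [[/(binding_unital bT) [s [h [uh uT iT]]] _]|[s iT]].
  exists s; have [g ug gT] : isomorphic (act h (permute_factors s T)) (T_utriv K n).
    (* For d = m^2 - 1 the d + 2 functions match the number of parameters exactly. *)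
    apply: extremal_utriv => //; move: iT; congr indep_fun.
    by rewrite -mulnn; lia.
  by exists (mul3 g h); [apply: GL3_mul | rewrite act_mul3].
split; last exact: binding_dim_le.
have -> : (n.+1 ^ 2 - 1 = n + n + n * n)%N by rewrite -mulnn; lia.
exact: utriv_chain iT.
Qed.

End Main.

(** Writing m as [n.+1] guarantees the basis vector a_1. Since [T_utriv] is itself binding, the
    equivalence applies to it and shows that the bound is attained. *)
Theorem proposition3p2 (R : realType) (n : nat) :
  (forall T : tensor R[i] n.+1, binding T ->
     dim_symmetry_le T (n.+1 ^ 2 - 1)%N) /\
  binding (T_utriv R[i] n) /\
  (forall T : tensor R[i] n.+1, binding T ->
     (dim_symmetry_eq T (n.+1 ^ 2 - 1)%N <->
      exists s : 'S_3, isomorphic (permute_factors s T) (T_utriv R[i] n))).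
Proof.
split; first by move=> T; apply: binding_dim_le.
split; first exact: utriv_binding.
by move=> T; apply: binding_dim_eq.
Qed.
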